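(* For integers $n>1$ and $k\ge 1$ let $X_k^n=\{(z_1,\dots,z_n,w)\in\mathbb{C}^{n+1} : z_1^2+\dots+z_n^2-w^k=0\}$, considered as a germ at the origin and equipped with its inner metric. Then for each $n>1$ and any pair of integers $k>l>1$, the germs $(X_k^n,\mathbf{0})$ and $(X_l^n,\mathbf{0})$ are not subanalytically bi-Lipschitz homeomorphic.
   Context: The inner metric on a subset $X$ of a Euclidean space is the metric in which the distance between two points is the infimum of the lengths of rectifiable curves in $X$ joining them. Two germs $(X,\mathbf{0})$ and $(X',\mathbf{0})$ are subanalytically bi-Lipschitz homeomorphic if there is a germ of subanalytic homeomorphism $(X,\mathbf{0})\to(X',\mathbf{0})$ which is Lipschitz with Lipschitz inverse with respect to the inner metrics. Here $\mathbb{C}^{n+1}$ is identified with $\mathbb{R}^{2n+2}$. *)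

(* Defs.v *)
From HB Require Import structures.
From mathcomp Require Import all_boot all_order all_algebra.
From mathcomp Require Import complex.
From mathcomp Require Import all_classical all_reals all_analysis.

Set Implicit Arguments.
Unset Strict Implicit.
Unset Printing Implicit Defensive.

Import Order.TTheory GRing.Theory Num.Theory.
Import numFieldNormedType.Exports.

Local Open Scope classical_set_scope.
Local Open Scope ring_scope.

(* The library norm `|v| on 'rV[R]_m is the sup norm. It induces the usual
   topology, but lengths of curves have to be measured with this one. *)
Definition enorm (R : realType) (m : nat) (v : 'rV[R]_m) : R :=
  Num.sqrt (\sum_i v 0 i ^+ 2).

Definition curve_length (R : realType) (m : nat) (gamma : R -> 'rV[R]_m) :
    \bar R :=
  ereal_sup [set (\sum_(x <- zip s (0 :: s)) enorm (gamma x.1 - gamma x.2))%:E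
            | s in [set s | itv_partition 0 1 s]].

Definition rectifiable_curve (R : realType) (m : nat) (X : set 'rV[R]_m)
    (x y : 'rV[R]_m) (gamma : R -> 'rV[R]_m) : Prop :=
  [/\ {within `[0, 1], continuous gamma}, gamma @` `[0, 1] `<=` X,
      gamma 0 = x, gamma 1 = y & (curve_length gamma < +oo)%E].

(* Equal to +oo when no rectifiable curve in X joins x to y. *)
Definition inner_dist (R : realType) (m : nat) (X : set 'rV[R]_m)
    (x y : 'rV[R]_m) : \bar R :=
  ereal_inf [set curve_length gamma | gamma in rectifiable_curve X x y].

Definition inner_lipschitz (R : realType) (m p : nat) (X : set 'rV[R]_m)
    (Y : set 'rV[R]_p) (h : 'rV[R]_m -> 'rV[R]_p) : Prop :=
  exists2 K : R, 0 < K & forall x y, X x -> X y ->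
    (inner_dist Y (h x) (h y) <= K%:E * inner_dist X x y)%E.

Definition monomial (R : realType) (m : nat) (alpha : {ffun 'I_m -> nat})
    (v : 'rV[R]_m) : R :=
  \prod_i v 0 i ^+ alpha i.

(* The sum of an absolutely summable real family is the difference of the sums
   of its positive and negative parts: \esum is only meant for nonnegative
   families. *)
Definition real_analytic_at (R : realType) (m : nat) (f : 'rV[R]_m -> R)
    (a : 'rV[R]_m) : Prop :=
  exists c : {ffun 'I_m -> nat} -> R, \forall x \near a,
    let t := fun alpha => (c alpha * monomial alpha (x - a))%:E in
    summable setT t /\
    (f x)%:E = (\esum_(alpha in setT) t^\+ alpha
                - \esum_(alpha in setT) t^\- alpha)%E.

Definition real_analytic_on (R : realType) (m : nat) (U : set 'rV[R]_m)
    (f : 'rV[R]_m -> R) : Prop :=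
  forall a, U a -> real_analytic_at f a.

(* Each point has a neighbourhood U in which S is a finite union of finite
   intersections of sets {f = 0} and {g > 0}, with f and g analytic on U. The
   same number q of equations and inequalities in every piece is no
   restriction, since f = 0 and g = 1 are allowed. *)
Definition semianalytic (R : realType) (m : nat) (S : set 'rV[R]_m) : Prop :=
  forall a : 'rV[R]_m, exists U : set 'rV[R]_m, open_nbhs a U /\
    exists (p q : nat) (f g : 'I_p -> 'I_q -> 'rV[R]_m -> R),
      (forall i j, real_analytic_on U (f i j) /\ real_analytic_on U (g i j)) /\
      S `&` U = [set x | exists i, forall j, f i j x = 0 /\ 0 < g i j x] `&` U.

Definition subanalytic (R : realType) (m : nat) (S : set 'rV[R]_m) : Prop :=
  forall a : 'rV[R]_m, exists U : set 'rV[R]_m, open_nbhs a U /\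
    exists (q : nat) (A : set 'rV[R]_(m + q)),
      [/\ semianalytic A, precompact A & S `&` U = lsubmx @` A].

Definition graph_on (R : realType) (m p : nat) (X : set 'rV[R]_m)
    (h : 'rV[R]_m -> 'rV[R]_p) : set 'rV[R]_(m + p) :=
  [set row_mx x (h x) | x in X].

(* g is the inverse of h; its graph is the transpose of that of h, hence
   subanalytic as well. *)
Definition subanalytic_homeomorphism (R : realType) (m p : nat)
    (X : set 'rV[R]_m) (Y : set 'rV[R]_p)
    (h : 'rV[R]_m -> 'rV[R]_p) (g : 'rV[R]_p -> 'rV[R]_m) : Prop :=
  [/\ set_fun X Y h, set_fun Y X g,
      {in X, cancel h g} /\ {in Y, cancel g h},
      {within X, continuous h} /\ {within Y, continuous g} &
      subanalytic (graph_on X h)].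

(* The germs (X, 0) and (Y, 0), for X and Y containing 0, are given by the
   representatives X `&` U and Y `&` V; each representative carries its own
   inner metric, so that the notion depends on the germs only. *)
Definition subanalytically_bilipschitz (R : realType) (m p : nat)
    (X : set 'rV[R]_m) (Y : set 'rV[R]_p) : Prop :=
  exists (U : set 'rV[R]_m) (V : set 'rV[R]_p)
         (h : 'rV[R]_m -> 'rV[R]_p) (g : 'rV[R]_p -> 'rV[R]_m),
    [/\ open_nbhs (0 : 'rV[R]_m) U /\ open_nbhs (0 : 'rV[R]_p) V,
        subanalytic_homeomorphism (X `&` U) (Y `&` V) h g,
        h 0 = 0,
        inner_lipschitz (X `&` U) (Y `&` V) h &
        inner_lipschitz (Y `&` V) (X `&` U) g].

Definition realify (R : realType) (m : nat) (z : 'rV[R[i]%C]_m) :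
    'rV[R]_(m + m) :=
  row_mx (map_mx (@complex.Re R) z) (map_mx (@complex.Im R) z).

(* z_1, ..., z_n are the first n coordinates of z, and w is the last one. *)
Definition singularity (R : realType) (n k : nat) : set 'rV[R[i]%C]_n.+1 :=
  [set z | \sum_(i < n) z 0 (widen_ord (leqnSn n) i) ^+ 2
           - z 0 ord_max ^+ k = 0].
Arguments singularity : clear implicits.

Definition real_singularity (R : realType) (n k : nat) :
    set 'rV[R]_(n.+1 + n.+1) :=
  @realify R n.+1 @` singularity R n k.
Arguments real_singularity : clear implicits.

(* Main.v *)
Require Import Defs.
From mathcomp Require Import all_boot all_order all_algebra.
From mathcomp Require Import ring lra zify complex.
From mathcomp Require Import all_classical all_reals all_analysis.

(** The germs are told apart by the size of the spheres that are essential at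
    their own scale.

    Over w = s > 0 the variety X_k is the affine quadric
    z_1^2 + ... + z_n^2 = s^k, whose real points form a sphere of radius
    s^(k/2). On X_k one has |Re z|^2 >= Re (z_1^2 + ... + z_n^2) = Re (w^k), so
    Re z does not vanish as long as w stays close to s, and z |-> Re z / |Re z|
    retracts this part of X_k onto the sphere. Hence the sphere cannot be
    contracted in X_k within a small fraction of s of itself
    ([sphere_essential]). This is a form of the no-retraction theorem; it is
    derived from the Poincare-Miranda theorem ([poincare_miranda]), which in
    turn rests on a parity argument for labelled grids ([kuhn_lemma]).

    In X_l, a point q at distance of order s from the origin has a z-part of
    size at least of order s^(l/2) ([zpart_lower_bound]), and the ball about q
    whose radius is a fixed fraction of that size retracts onto X_l by a
    Lipschitz map ([local_retraction]). So a small set near q can be contracted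
    in X_l at no more than its own scale: cone it off in the ambient ball and
    retract.

    Let h be bi-Lipschitz from X_k to X_l, with k > l > 1 and inverse g. The
    image of the sphere over w = s has diameter of order s^(k/2)
    ([sphere_diameter]) and lies at distance of order s from the origin
    ([radial_lipschitz] for h and for g). As s^(k/2) is much smaller than
    s^(l/2), the image can be contracted in X_l at scale s^(k/2), and g carries
    the contraction back to X_k, within O(s^(k/2)) of the sphere. But k > 2
    makes s^(k/2) much smaller than s: contradiction.

    The inner metrics enter only through Lipschitz paths: such a path bounds an
    inner distance from above, the chord bounds it from below. The maps to
    which the Poincare-Miranda theorem is applied are Lipschitz as well, which
    makes all estimates explicit; s = t^2 is a fixed small number. *)

Set Implicit Arguments.
Unset Strict Implicit.
Unset Printing Implicit Defensive.

Import Order.TTheory GRing.Theory Num.Theory.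
Import numFieldNormedType.Exports.

Local Open Scope ring_scope.

Import Normc.

(** * Cup products on the cubical grid and Kuhn's lemma *)

Lemma addF2 (x : 'F_2) : x + x = 0.
Proof. by apply: (@addrr_pchar2 'F_2); apply: pchar_Fp. Qed.

Section Grid.
Variable I : finType.
Implicit Types (D : {set I}) (u v : {ffun I -> nat}) (ds : seq I).

Definition grid_dir (i : I) : {ffun I -> nat} := [ffun j => (j == i) : nat].

(** The cup product of the coboundaries of the 0-cochains in L, evaluated on
    the cube with corner v and directions D: a sum over the monotone lattice
    paths from v to the opposite corner, that is, over the simplices of Kuhn's
    triangulation of the cube. Modulo 2 these carry no signs. *)
Fixpoint cup (L : seq ({ffun I -> nat} -> 'F_2)) D v : 'F_2 :=
  if L is a :: L' then
    \sum_(j in D) (a (v + grid_dir j) + a v) * cup L' (D :\ j) (v + grid_dir j)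
  else 1.

Lemma sum_symmetric_F2 D (F : I -> I -> 'F_2) :
  (forall i j, F i j = F j i) -> \sum_(i in D) \sum_(j in D :\ i) F i j = 0.
Proof.
move=> Fsym; rewrite pair_big_dep /=.
rewrite (bigID (fun q : I * I => enum_rank q.1 < enum_rank q.2)%N) /=.
pose sw (q : I * I) := (q.2, q.1).
have swK : involutive sw by case.
rewrite [X in _ + X](reindex_inj (inv_inj swK)) /=.
rewrite [X in _ + X](eq_big
  (fun q => [&& q.1 \in D, q.2 \in D :\ q.1 & (enum_rank q.1 < enum_rank q.2)%N])
  (fun q => F q.1 q.2)) /=.
- under eq_bigl => q do rewrite -andbA.
  exact: addF2.
- move=> [i j] /=; rewrite !in_setD1;
  case: (i \in D) (j \in D) => -[] //=; rewrite ?andbF //=.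
  rewrite -leqNgt leq_eqVlt eq_sym andbT eq_sym.
  have [->|ne] := eqVneq i j; rewrite /= ?ltnn //.
  case: eqVneq => //= /ord_inj/enum_rank_inj E.
  by rewrite E eqxx in ne.
- by move=> q _; rewrite Fsym.
Qed.

(** A product of coboundaries is closed. The terms with the value of the first
    cochain two steps away from v cancel, because the two steps can be taken in
    either order; by induction the others vanish or cancel for the same
    reason. *)
Lemma cup_closed L D v :
  \sum_(j in D) (cup L (D :\ j) (v + grid_dir j) + cup L (D :\ j) v) = 0.
Proof.
elim: L D v => [|a L IH] D v /=; first by rewrite big1 // => j _; apply: addF2.
pose P i j u := cup L (D :\ j :\ i) u.
have Psym i j u : P i j u = P j i u by rewrite /P !finset.setDDl finset.setUC.
pose e := grid_dir.
transitivity (\sum_(j in D) \sum_(i in D :\ j)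
    (a (v + e j + e i) * P i j (v + e j + e i)
     + a (v + e j) * P i j (v + e j + e i)
     + (a (v + e i) * P i j (v + e i) + a v * P i j (v + e i)))).
  by apply: eq_bigr => j _; rewrite -big_split; apply: eq_bigr => i _; rewrite !mulrDl.
have sp (F G : I -> I -> 'F_2) : \sum_(j in D) \sum_(i in D :\ j) (F i j + G i j)
   = \sum_(j in D) \sum_(i in D :\ j) F i j + \sum_(j in D) \sum_(i in D :\ j) G i j.
  by rewrite -big_split; apply: eq_bigr => j _; rewrite -big_split.
rewrite !sp.
rewrite [X in X + _ + _]sum_symmetric_F2 ?add0r; last first.
  by move=> i j; rewrite Psym addrAC.
have -> : \sum_(j in D) \sum_(i in D :\ j) a (v + e i) * P i j (v + e i)
  = \sum_(j in D) \sum_(i in D :\ j) a (v + e j) * P i j (v + e j).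
  rewrite !pair_big_dep /=.
  pose sw (q : I * I) := (q.2, q.1).
  have swK : involutive sw by case.
  rewrite (reindex_inj (inv_inj swK)) /=; apply: eq_big.
    by move=> [i j] /=; rewrite !in_setD1 [i == j]eq_sym;
      case: (j == i) (i \in D) (j \in D) => [] [] [].
  by move=> [i j] _ /=; rewrite Psym.
have -> : \sum_(j in D) \sum_(i in D :\ j) a v * P i j (v + e i) = 0.
  transitivity (\sum_(j in D) \sum_(i in D :\ j) a v * P i j v).
    apply: eq_bigr => j _; rewrite -!mulr_sumr; congr (_ * _).
    have /eqP := IH (D :\ j) v; rewrite big_split /= addr_eq0 => /eqP ->.
    apply/eqP; rewrite eq_sym -addr_eq0; exact/eqP/addF2.
  by apply: sum_symmetric_F2 => i j; rewrite Psym.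
rewrite addr0 -sp; apply: big1 => j _.
under eq_bigr do rewrite -mulrDr.
by rewrite -mulr_sumr IH mulr0.
Qed.

(** As the product of the other factors is closed, the first coboundary can be
    integrated by parts; the result telescopes over a box. *)
Lemma cup_exact a L D v : let Q j u := a u * cup L (D :\ j) u in
  cup (a :: L) D v = \sum_(j in D) (Q j (v + grid_dir j) + Q j v).
Proof.
move=> Q /=.
transitivity (\sum_(j in D) (Q j (v + grid_dir j) + Q j v)
    + a v * \sum_(j in D) (cup L (D :\ j) (v + grid_dir j) + cup L (D :\ j) v));
  last by rewrite cup_closed mulr0 addr0.
rewrite mulr_sumr -big_split.
apply: eq_bigr => j _; rewrite /Q /= mulrDl mulrDr -addrA; congr (_ + _).
by rewrite addrCA addF2 addr0.
Qed.

(** This serves twice: on a face of the grid the label of the normal direction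
    is constant, which kills boundary terms, and a cube with nonzero product
    must show both values of each label. *)
Lemma cup_const0 (lab : I -> {ffun I -> nat} -> 'F_2) ds i c D v : i \in ds ->
  (forall u, (forall j, v j <= u j <= v j + (j \in D))%N -> lab i u = c) ->
  cup [seq lab j | j <- ds] D v = 0.
Proof.
elim: ds D v => //= d ds IH D v; rewrite in_cons => ids labc.
apply: big1 => j jD; have [di|di] := eqVneq i d.
  rewrite -di !labc ?addF2 ?mul0r //.
    by move=> k; rewrite leqnn leq_addr.
  move=> k; rewrite !ffunE /=; case: eqVneq => [->|_]; rewrite ?jD; lia.
rewrite (negPf di) in ids.
rewrite (IH _ _ ids) ?mulr0 // => u uP; apply: labc => k.
have := uP k; rewrite !ffunE in_setD1 /=; case: eqVneq => [->|_] /=; rewrite ?jD /=; lia.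
Qed.

Variable p : nat.

(** Directions are listed so that an induction can remove them one by one
    together with the factors of a cup product. *)
Fixpoint box_sum ds (F : {ffun I -> nat} -> 'F_2) v : 'F_2 :=
  if ds is d :: ds' then \sum_(x < p) box_sum ds' F (v + grid_dir d *+ x) else F v.

Lemma dirMn d x j : (grid_dir d *+ x) j = if j == d then x else 0%N.
Proof.
by rewrite ffunMnE ffunE; case: eqP => _; rewrite ?mul0rn // -mulr_natl mulr1 natn.
Qed.

Lemma eq_box_sum ds F G v : uniq ds ->
  (forall u, (forall i, if i \in ds then v i <= u i < v i + p else u i == v i)%N ->
     F u = G u) -> box_sum ds F v = box_sum ds G v.
Proof.
elim: ds v => [|d ds IH] v /=.
  by move=> _; apply => i; rewrite eqxx.
case/andP=> dds uds FG; apply: eq_bigr => x _; apply: IH => // u uP; apply: FG => i.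
have := uP i; rewrite in_cons !ffunE dirMn.
have := ltn_ord x.
case: eqVneq => [->|_] /=; first by rewrite (negPf dds); lia.
case: ifP; lia.
Qed.

Lemma box_sum0 ds v : box_sum ds (fun=> 0) v = 0.
Proof. by elim: ds v => //= d ds IH v; rewrite big1. Qed.

Lemma box_sumD ds F G v :
  box_sum ds (fun u => F u + G u) v = box_sum ds F v + box_sum ds G v.
Proof. by elim: ds v => //= d ds IH v; rewrite -big_split; apply: eq_bigr. Qed.

Lemma box_sum_sum ds (D : {set I}) (F : I -> _ -> 'F_2) v :
  box_sum ds (fun u => \sum_(j in D) F j u) v = \sum_(j in D) box_sum ds (F j) v.
Proof.
elim: ds v => //= d ds IH v.
by rewrite exchange_big; apply: eq_bigr => x _; rewrite IH.
Qed.

Lemma box_sum_shift ds F v w :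
  box_sum ds (fun u => F (u + w)) v = box_sum ds F (v + w).
Proof.
by elim: ds v => //= d ds IH v; apply: eq_bigr => x _; rewrite IH addrAC.
Qed.

Lemma box_sum_telescope d ds F v :
  box_sum (d :: ds) (fun u => F (u + grid_dir d) + F u) v
  = box_sum ds F (v + grid_dir d *+ p) + box_sum ds F v.
Proof.
rewrite /=.
elim: p => [|q IH]; first by rewrite big_ord0 mulr0n addr0 addF2.
rewrite big_ord_recr IH /= box_sumD box_sum_shift -(addrA v) -mulrSr.
set A := box_sum _ _ _; set B := box_sum _ _ _; set E := box_sum _ _ _.
by rewrite addrC -addrA (addrA A) addF2 add0r.
Qed.

Lemma box_sum_face0 ds j F v : uniq ds -> j \in ds -> v j = 0%N ->
  (forall u, u j = 0%N \/ u j = p -> F u = 0) ->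
  box_sum ds (fun u => F (u + grid_dir j) + F u) v = 0.
Proof.
move=> + + + F0; elim: ds v => // d ds IH v /andP[dds uds].
rewrite in_cons; have [jd _ vj|jd /= jds vj] := eqVneq j d.
  rewrite -jd in dds *; rewrite box_sum_telescope.
  have face0 (w : {ffun I -> nat}) : w j = 0%N \/ w j = p -> box_sum ds F w = 0.
    move=> wj; rewrite -(box_sum0 ds w); apply: eq_box_sum => // u /(_ j).
    by rewrite (negPf dds) => /eqP uj; apply: F0; rewrite uj.
  by rewrite !face0 ?addr0 ?ffunE ?dirMn ?vj ?eqxx; [|left|right].
rewrite big1 // => x _; apply: IH => //.
by rewrite ffunE dirMn (negPf jd) vj.
Qed.

Variable lab : I -> {ffun I -> nat} -> 'F_2.
Hypothesis lab0 : forall i u, u i = 0%N -> lab i u = 0.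
Hypothesis labp : forall i u, u i = p -> lab i u = 1.

(** Stokes' formula on the grid. Once the first coboundary is integrated, the
    faces orthogonal to the other directions contribute nothing, because there
    the label of the normal direction is constant. Of the two faces orthogonal
    to the first direction, the one where its label is 0 drops out, and the
    other one carries the same sum in one dimension less. *)
Lemma box_sum_cup ds v : uniq ds -> (forall i, i \in ds -> v i = 0%N) ->
  box_sum ds (cup [seq lab i | i <- ds] [set i in ds]) v = 1.
Proof.
elim: ds v => // d ds IH v /andP[dds uds] v0.
pose L := [seq lab i | i <- ds]; pose D := [set i in d :: ds].
pose Q j u := lab d u * cup L (D :\ j) u.
have Dd : D :\ d = [set i in ds].
  by apply/finset.setP => i; rewrite !inE; case: eqVneq => //= ->; rewrite (negPf dds).
transitivity (box_sum (d :: ds) (fun u => \sum_(j in D) (Q j (u + grid_dir j) + Q j u)) v).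
  by apply: eq_box_sum => /=; [apply/andP | move=> u _; exact: cup_exact].
rewrite box_sum_sum (bigD1 d) /=; last by rewrite !inE eqxx.
rewrite -[X in X + _]/(box_sum (d :: ds) (fun u => Q d (u + grid_dir d) + Q d u) v).
rewrite box_sum_telescope [X in _ + X]big1 ?addr0.
  rewrite -[RHS]addr0; congr (_ + _).
    rewrite -(IH (v + grid_dir d *+ p)) //; last first.
      move=> i ids; rewrite ffunE dirMn v0 ?in_cons ?ids ?orbT //.
      by case: eqVneq => [id|//]; rewrite -id ids in dds.
    apply: eq_box_sum => // u /(_ d); rewrite (negPf dds) => /eqP ud.
    by rewrite /Q Dd labp ?mul1r // ud ffunE dirMn eqxx v0 ?in_cons ?eqxx.
  rewrite -(box_sum0 ds v); apply: eq_box_sum => // u /(_ d).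
  rewrite (negPf dds) => /eqP ud.
  by rewrite /Q lab0 ?mul0r // ud v0 // in_cons eqxx.
move=> j /andP[jD jd].
rewrite -[LHS]/(box_sum (d :: ds) (fun u => Q j (u + grid_dir j) + Q j u) v).
apply: box_sum_face0 => //; first by rewrite /= dds.
- by rewrite inE in jD.
- by apply: v0; rewrite inE in jD.
move=> u uj; rewrite /Q (@cup_const0 _ _ j (lab j u)) ?mulr0 //.
  by move: jD; rewrite !inE (negPf jd).
move=> w /(_ j); rewrite !inE eqxx /= => wj.
have {wj}wj : w j = u j by lia.
by case: uj => uj; [rewrite !lab0|rewrite !labp]; rewrite ?wj.
Qed.

End Grid.

(** If some label were constant on each grid cube, all the cup products would
    vanish, whereas they add up to 1. *)
Lemma kuhn_lemma (I : finType) (p : nat) (lab : I -> {ffun I -> nat} -> bool) :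
  (forall i (u : {ffun I -> nat}), u i = 0%N -> ~~ lab i u) ->
  (forall i (u : {ffun I -> nat}), u i = p -> lab i u) ->
  exists u : {ffun I -> nat}, (forall i, u i < p)%N /\
    forall i, exists u1 u2 : {ffun I -> nat},
     [/\ forall j, (u j <= u1 j <= (u j).+1)%N, forall j, (u j <= u2 j <= (u j).+1)%N,
         lab i u1 & ~~ lab i u2].
Proof.
move=> lab0 labp; apply: contrapT => nex.
pose lab2 i u : 'F_2 := (lab i u)%:R.
suff E : box_sum p (enum I) (cup [seq lab2 i | i <- enum I] [set i in enum I]) 0 = 0.
  move: E; rewrite box_sum_cup ?enum_uniq //.
  - by move=> i u ui; rewrite /lab2 (negPf (lab0 _ _ ui)).
  - by move=> i u ui; rewrite /lab2 labp.
  - by move=> i _; rewrite ffunE.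
rewrite -(box_sum0 p (enum I) 0); apply: eq_box_sum; first exact: enum_uniq.
move=> u uP; apply: contrapT => /eqP cu0; apply: nex; exists u; split=> [i|i].
  by have := uP i; rewrite mem_enum /= ffunE.
apply: contrapT => nex; move/eqP: cu0; apply.
apply: (@cup_const0 _ _ _ i (lab2 i u)); first by rewrite mem_enum.
move=> w wP; rewrite /lab2.
have w1 j : (u j <= w j <= (u j).+1)%N.
  by have := wP j; rewrite inE mem_enum addn1.
have u1 j : (u j <= u j <= (u j).+1)%N by rewrite leqnn leqnSn.
have [lu|lu] := boolP (lab i u); have [lw|lw] := boolP (lab i w) => //.
  by case: nex; exists u, w.
by case: nex; exists w, u.
Qed.

(** * The Poincare-Miranda theorem *)

Section PoincareMiranda.
Variable R : realType.

Definition in_cube n (v : 'rV[R]_n) := forall i, `|v 0 i| <= 1.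

(** Kuhn's lemma, applied to the signs of the coordinates of f, gives a grid
    cube on which every coordinate takes both signs; a coordinate that does so
    on a cube much smaller than eta / L stays below eta there. *)
Lemma poincare_miranda n (f : 'rV[R]_n -> 'rV[R]_n) (L : R) :
  (forall v v' (d : R), in_cube v -> in_cube v' -> (forall i, `|v 0 i - v' 0 i| <= d) ->
     forall i, `|f v 0 i - f v' 0 i| <= L * d) ->
  (forall v i, in_cube v -> v 0 i = -1 -> f v 0 i < 0) ->
  (forall v i, in_cube v -> v 0 i = 1 -> 0 < f v 0 i) ->
  forall eta : R, 0 < eta -> exists2 v, in_cube v & forall i, `|f v 0 i| < eta.
Proof.
move=> fL fneg fpos eta eta0.
pose p := (Num.bound (2 * `|L| / eta)).+1.
have p0 : 0 < p%:R :> R by rewrite ltr0n.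
have Lp : 2 * `|L| / p%:R < eta.
  rewrite ltr_pdivrMr // [ltRHS]mulrC -ltr_pdivrMr //.
  have : 2 * `|L| / eta < (Num.bound (2 * `|L| / eta))%:R.
    by apply: archi_boundP; rewrite divr_ge0 ?mulr_ge0 // ltW.
  by move=> /lt_trans; apply; rewrite ltr_nat.
clearbody p.
pose x (u : {ffun 'I_n -> nat}) : 'rV[R]_n := \row_i (2 * (u i)%:R / p%:R - 1).
have xcube (u : {ffun _ -> nat}) : (forall i, u i <= p)%N -> in_cube (x u).
  move=> up i; rewrite mxE ler_norml.
  have : 0 <= (u i)%:R / p%:R :> R by rewrite divr_ge0.
  have : (u i)%:R / p%:R <= 1 :> R by rewrite ler_pdivrMr // mul1r ler_nat.
  by rewrite -mulrA; lra.
(* On the faces of the grid the label is prescribed, in agreement with the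
   sign of f there. *)
pose lab i (u : {ffun 'I_n -> nat}) := (p <= u i)%N || ((0 < u i)%N && (0 < f (x u) 0 i)).
have [||u [up ulab]] := @kuhn_lemma _ p lab.
- by move=> i u ui; rewrite /lab ui /= orbF -ltnNge -(ltr0n R).
- by move=> i u ui; rewrite /lab ui leqnn.
have uc : in_cube (x u) by apply: xcube => i; rewrite ltnW.
exists (x u) => // i.
have [u1 [u2 [u1P u2P lab1 lab2]]] := ulab i.
have near (w : {ffun _ -> nat}) : (forall j, u j <= w j <= (u j).+1)%N ->
    in_cube (x w) /\ `|f (x u) 0 i - f (x w) 0 i| < eta.
  move=> wP.
  have wc : in_cube (x w) by apply: xcube => j; have := wP j; have := up j; lia.
  split=> //; apply: le_lt_trans Lp.
  apply: le_trans (fL _ _ (2 / p%:R) uc wc _ i) _.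
    move=> j; rewrite !mxE.
    have /andP[uw wu] := wP j.
    have d0 : 0 <= ((w j)%:R - (u j)%:R) / p%:R :> R.
      by rewrite divr_ge0 // subr_ge0 ler_nat.
    have d1 : ((w j)%:R - (u j)%:R) / p%:R <= 1 / p%:R :> R.
      by rewrite ler_pM2r ?invr_gt0 // lerBlDl natr1 ler_nat.
    rewrite ler_norml; move: d0 d1; rewrite mulrBl -!mulrA div1r; lra.
  by rewrite mulrCA -mulrA ler_pM2l // ler_pM2r ?invr_gt0 // ler_norm.
have [c1 n1] := near _ u1P; have [c2 n2] := near _ u2P.
have f1 : 0 < f (x u1) 0 i.
  case/orP: lab1 => [pu|/andP[]//].
  apply: fpos => //; rewrite mxE.
  have -> : u1 i = p.
    by apply/eqP; rewrite eqn_leq pu andbT;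
    have /andP[_ h] := u1P i; exact: leq_trans h (up i).
  by rewrite -mulrA divff ?gt_eqF // mulr1; ring.
have f2 : f (x u2) 0 i <= 0.
  move: lab2; rewrite negb_or => /andP[_]; rewrite negb_and => /orP[|]; last by rewrite -leNgt.
  rewrite -leqNgt leqn0 => /eqP u20; apply/ltW/fneg => //; rewrite mxE u20.
  by rewrite mulr0 mul0r sub0r.
by move: n1 n2; rewrite !ltr_norml => /andP[? ?] /andP[? ?]; lra.
Qed.
End PoincareMiranda.

(** * Inner distances and Lipschitz curves *)

Section Curves.
Variable R : realType.

Lemma coord_le_enorm m (v : 'rV[R]_m) i : `|v 0 i| <= enorm v.
Proof.
rewrite -sqrtr_sqr /enorm ler_wsqrtr // (bigD1 i) //= lerDl.
by apply: sumr_ge0 => j _; apply: sqr_ge0.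
Qed.

Lemma enorm_le_coord m (v : 'rV[R]_m) (d : R) :
  0 <= d -> (forall i, `|v 0 i| <= d) -> enorm v <= m%:R * d.
Proof.
move=> d0 vd; rewrite -[leRHS]ger0_norm ?mulr_ge0 // -sqrtr_sqr /enorm ler_wsqrtr //.
apply: (@le_trans _ _ (\sum_(i < m) d ^+ 2)).
  by apply: ler_sum => i _; rewrite -real_normK ?num_real // ler_sqr ?nnegrE ?vd.
rewrite big_const_ord iter_addr_0 exprMn -[leLHS]mulr_natl
  ler_wpM2r ?sqr_ge0 // -natrX ler_nat.
by case: m v vd => // m v vd; rewrite leq_pmulr.
Qed.

(** The partition of [0, 1] into one interval already yields the chord. *)
Lemma enorm_le_inner_dist m (X : set 'rV[R]_m) x y :
  ((enorm (x - y))%:E <= inner_dist X x y)%E.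
Proof.
apply: le_ereal_inf_tmp => _ [c [_ _ <- <-] _] <-; apply: ereal_sup_ubound.
exists [:: 1].
  by split => /=; rewrite ?ltr01 ?eqxx.
rewrite /= big_seq1 /=; congr (_%:E); rewrite /enorm; congr Num.sqrt.
by apply: eq_bigr => i _; rewrite !mxE -sqrrN opprB.
Qed.

Lemma curve_length_lipschitz m (c : R -> 'rV[R]_m) (L : R) :
  (forall s t : R, 0 <= s <= 1 -> 0 <= t <= 1 -> enorm (c s - c t) <= L * `|s - t|) ->
  (curve_length c <= L%:E)%E.
Proof.
move=> cL; apply: ge_ereal_sup => _ [s sP <-]; rewrite lee_fin.
suff: forall a : R, 0 <= a -> itv_partition a 1 s ->
    \sum_(x <- zip s (a :: s)) enorm (c x.1 - c x.2) <= L * (1 - a).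
  by move=> /(_ 0 (lexx _) sP); rewrite subr0 mulr1.
elim: s {sP} => [|b s IH] a a0 ab.
  by rewrite big_nil (itv_partition_nil ab) subrr mulr0.
have bs := itv_partition_cons ab.
have ltab : a < b by case: ab => /= /andP[].
have b1 := itv_partition_le bs.
have b0 : 0 <= b by rewrite (le_trans a0) // ltW.
rewrite /= big_cons /=.
have -> : L * (1 - a) = L * `|b - a| + L * (1 - b).
  by rewrite gtr0_norm ?subr_gt0 //; ring.
apply: lerD; last exact: IH.
by apply: cL; rewrite ?a0 ?b0 ?b1 //= (le_trans (ltW ltab)).
Qed.

Lemma rV_norm_le m (v : 'rV[R]_m) (d : R) :
  0 <= d -> (forall i, `|v 0 i| <= d) -> `|v| <= d.
Proof.
move=> d0 vd; rewrite /Num.norm /= mx_normrE; apply: bigmax_le => // -[i j] _ /=.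
by rewrite ord1.
Qed.

(** The source of all upper bounds for inner distances: being Lipschitz makes a
    parametrization continuous and bounds the length of the curve. *)
Lemma inner_dist_lipschitz m (X : set 'rV[R]_m) (c : R -> 'rV[R]_m) (L : R) :
  (forall s : R, 0 <= s <= 1 -> X (c s)) ->
  (forall s t : R, 0 <= s <= 1 -> 0 <= t <= 1 -> enorm (c s - c t) <= L * `|s - t|) ->
  (inner_dist X (c 0%R) (c 1%R) <= L%:E)%E.
Proof.
move=> cX cL; have len := curve_length_lipschitz cL.
apply: (le_trans _ len); apply: ereal_inf_lbound; exists c => //; split=> //.
- apply/subspace_continuousP => x /=; rewrite in_itv /= => x01.
  apply/cvgrPdist_le => e e0; rewrite near_withinE.
  apply/nbhs_ballP; exists (e / (`|L| + 1)) => /=; first by rewrite divr_gt0 ?ltr_wpDl.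
  move=> y; rewrite /ball /= => xy; rewrite in_itv /= => y01.
  apply: rV_norm_le; first exact: ltW.
  move=> i; apply: le_trans (coord_le_enorm _ _) _.
  apply: le_trans (cL _ _ x01 y01) _.
  apply: (@le_trans _ _ ((`|L| + 1) * `|x - y|)).
    by rewrite ler_wpM2r // ler_wpDr // ler_norm.
  by rewrite mulrC -ler_pdivlMr ?ltr_wpDl // ltW.
- by move=> ? [s] /=; rewrite in_itv /= => s01 <-; exact: cX.
- exact: le_lt_trans len (ltry _).
Qed.

End Curves.

(** * Complex coordinates *)

Section CNorm.
Variable R : realType.
Local Notation C := R[i]%C.

Lemma normc_ge0 (x : C) : 0 <= normc x.
Proof. by case: x => a b; rewrite sqrtr_ge0. Qed.

Lemma normcD (x y : C) : normc (x + y) <= normc x + normc y.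
Proof. exact: (@le_normcD R x y). Qed.

Lemma normcB (x y : C) : normc (x - y) = normc (y - x).
Proof. by rewrite -opprB; exact: (@normcN R (y - x)). Qed.

Lemma normcX (x : C) k : normc (x ^+ k) = normc x ^+ k.
Proof. by elim: k => [|k IH]; rewrite ?normc1 // !exprS normcM IH. Qed.

Lemma normcR (a : R) : normc (a%:C)%C = `|a|.
Proof. by rewrite /normc /= expr0n addr0 sqrtr_sqr. Qed.

Lemma normc_sum (I : Type) (r : seq I) (P : pred I) (F : I -> C) :
  normc (\sum_(i <- r | P i) F i) <= \sum_(i <- r | P i) normc (F i).
Proof.
elim/big_rec2: _ => [|i y x _ IH]; first by rewrite normc0.
by apply: le_trans (normcD _ _) _; rewrite lerD2l.
Qed.

Lemma Re_le_normc (x : C) : `|complex.Re x| <= normc x.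
Proof. by case: x => a b /=; rewrite -sqrtr_sqr ler_wsqrtr // lerDl sqr_ge0. Qed.

Lemma Im_le_normc (x : C) : `|complex.Im x| <= normc x.
Proof. by case: x => a b /=; rewrite -sqrtr_sqr ler_wsqrtr // lerDr sqr_ge0. Qed.

(** A norm that can be estimated one complex coordinate at a time. Up to a
    factor that depends on m it is the Euclidean norm of the realification. *)
Definition cnorm m (z : 'rV[C]_m) : R := \big[Num.max/0]_i normc (z 0 i).

Lemma normc_le_cnorm m (z : 'rV[C]_m) i : normc (z 0 i) <= cnorm z.
Proof. by rewrite /cnorm; apply: (@le_bigmax _ _ _ 0 (fun i => normc (z 0 i)) i). Qed.

Lemma cnorm_ge0 m (z : 'rV[C]_m) : 0 <= cnorm z.
Proof. exact: bigmax_ge_id. Qed.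

Lemma cnorm_le m (z : 'rV[C]_m) (d : R) :
  0 <= d -> (forall i, normc (z 0 i) <= d) -> cnorm z <= d.
Proof. by move=> d0 zd; apply: bigmax_le. Qed.

Lemma cnormD m (z w : 'rV[C]_m) : cnorm (z + w) <= cnorm z + cnorm w.
Proof.
apply: cnorm_le => [|i]; first by rewrite addr_ge0 ?cnorm_ge0.
by rewrite mxE (le_trans (normcD _ _)) // lerD ?normc_le_cnorm.
Qed.

Lemma cnormB m (z w : 'rV[C]_m) : cnorm (z - w) = cnorm (w - z).
Proof. by rewrite /cnorm; apply: eq_bigr => i _; rewrite !mxE normcB. Qed.

Lemma cnorm_triangle m (x y z : 'rV[C]_m) :
  cnorm (x - z) <= cnorm (x - y) + cnorm (y - z).
Proof. by apply: le_trans (cnormD _ _); rewrite addrA subrK. Qed.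

Lemma cnorm0 m : cnorm (0 : 'rV[C]_m) = 0.
Proof. by apply/le_anti; rewrite cnorm_ge0 cnorm_le // => i; rewrite mxE normc0. Qed.

Definition unrealify m (v : 'rV[R]_(m + m)) : 'rV[C]_m :=
  \row_i Complex (lsubmx v 0 i) (rsubmx v 0 i).

Lemma realifyK m : cancel (@realify R m) (@unrealify m).
Proof.
move=> z; apply/rowP => i; rewrite mxE /realify row_mxKl row_mxKr !mxE.
by case: (z 0 i).
Qed.

Lemma unrealifyK m : cancel (@unrealify m) (@realify R m).
Proof.
move=> v; rewrite -[RHS]hsubmxK /realify; congr row_mx;
  by apply/rowP => i; rewrite !mxE.
Qed.

Lemma realifyB m (z w : 'rV[C]_m) : realify (z - w) = realify z - realify w.
Proof.
rewrite /realify opp_row_mx add_row_mx; congr row_mx;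
  by apply/rowP => i; rewrite !mxE; case: (z 0 i) (w 0 i) => [a b] [c d].
Qed.

Lemma realify0 m : realify (0 : 'rV[C]_m) = 0.
Proof. by have := realifyB (0 : 'rV[C]_m) 0; rewrite !subrr. Qed.

Lemma normc_coord_le_enorm m (z : 'rV[C]_m) i : normc (z 0 i) <= enorm (realify z).
Proof.
rewrite /enorm big_split_ord /= (bigD1 i) //= [X in _ + X](bigD1 i) //=.
rewrite /realify row_mxEl row_mxEr !mxE.
case: (z 0 i) => a b /=; rewrite ler_wsqrtr // addrACA lerDl addr_ge0 // sumr_ge0 // => j _;
exact: sqr_ge0.
Qed.

Lemma cnorm_le_enorm m (z : 'rV[C]_m) : cnorm z <= enorm (realify z).
Proof. by apply: cnorm_le => [|i]; rewrite ?sqrtr_ge0 ?normc_coord_le_enorm. Qed.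

Lemma realify_coord_le m (z : 'rV[C]_m) i : `|realify z 0 i| <= cnorm z.
Proof.
rewrite /realify -(fintype.splitK i); case: (fintype.split i) => j /=.
  by rewrite row_mxEl mxE (le_trans (Re_le_normc _)) ?normc_le_cnorm.
by rewrite row_mxEr mxE (le_trans (Im_le_normc _)) ?normc_le_cnorm.
Qed.

Lemma enorm_le_cnorm m (z : 'rV[C]_m) : enorm (realify z) <= (m + m)%:R * cnorm z.
Proof. by apply: enorm_le_coord => [|i]; rewrite ?cnorm_ge0 ?realify_coord_le. Qed.

Definition lipschitz_path m (X : set 'rV[C]_m) (c : R -> 'rV[C]_m) (L : R) : Prop :=
  (forall s : R, 0 <= s <= 1 -> X (c s)) /\
  forall s t : R, 0 <= s <= 1 -> 0 <= t <= 1 -> cnorm (c s - c t) <= L * `|s - t|.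

(** The trace that an inner Lipschitz map leaves on end points of paths; the
    inner metric, which can be infinite, no longer appears. *)
Definition path_lipschitz m p (X : set 'rV[C]_m) (K : R) (f : 'rV[C]_m -> 'rV[C]_p) : Prop :=
  forall c L, 0 <= L -> lipschitz_path X c L -> cnorm (f (c 0) - f (c 1)) <= K * L.

(** A path bounds the inner distance of its end points from above, and the
    chord bounds the inner distance of their images from below. The subset X'
    makes room for passing from neighbourhoods of the origin to balls. *)
Lemma inner_lipschitz_path m p (X : set 'rV[R]_(m + m)) (Y : set 'rV[R]_(p + p)) h :
  inner_lipschitz X Y h ->
  exists K, forall X' : set 'rV[C]_m, (forall z, X' z -> X (realify z)) ->
  path_lipschitz X' K (@unrealify p \o h \o @realify R m).
Proof.
case=> K K0 hK; exists (K * (m + m)%:R) => X' X'X c L L0 [cX cL].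
have dist : (inner_dist X (realify (c 0%R)) (realify (c 1%R)) <= ((m + m)%:R * L)%:E)%E.
  apply: (@inner_dist_lipschitz _ _ _ (fun s => realify (c s))) => [s s01|s t s01 t01].
    exact/X'X/cX.
  rewrite -realifyB (le_trans (enorm_le_cnorm _)) // -mulrA ler_wpM2l //.
  exact: cL.
have c0 : X' (c 0) by apply: cX; rewrite lexx ler01.
have c1 : X' (c 1) by apply: cX; rewrite lexx ler01.
have := hK _ _ (X'X _ c0) (X'X _ c1).
move=> /(le_trans (enorm_le_inner_dist _ _ _)) hle.
have : ((enorm (h (realify (c 0%R)) - h (realify (c 1%R))))%:E <= (K * (m + m)%:R * L)%:E)%E.
  apply: le_trans hle _; rewrite -mulrA EFinM; apply: lee_wpmul2l dist.
  by rewrite lee_fin ltW.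
rewrite lee_fin; apply: le_trans.
by apply: le_trans (cnorm_le_enorm _) _; rewrite realifyB /= !unrealifyK.
Qed.

Definition ball_singularity n k (r : R) : set 'rV[C]_n.+1 :=
  [set z | singularity R n k z /\ cnorm z < r].

Lemma open_nbhs0_ball m (U : set 'rV[R]_(m + m)) : open_nbhs (0 : 'rV[R]_(m + m)) U ->
  exists2 r : R, 0 < r & forall z : 'rV[C]_m, cnorm z < r -> U (realify z).
Proof.
rewrite open_nbhsE => -[_ /nbhs_ballP[r /= r0 rU]]; exists r => // z zr; apply: rU.
rewrite -ball_normE /ball_ /= sub0r normrN.
apply: le_lt_trans zr; apply: rV_norm_le; first exact: cnorm_ge0.
exact: realify_coord_le.
Qed.

(** A bi-Lipschitz homeomorphism of germs in complex coordinates, on balls that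
    fit into both representatives. *)
Lemma bilipschitz_path_lipschitz n k l :
  subanalytically_bilipschitz (real_singularity R n k) (real_singularity R n l) ->
  exists h g : 'rV[C]_n.+1 -> 'rV[C]_n.+1, exists r K : R,
  [/\ 0 < r <= 1 /\ 1 <= K, h 0 = 0,
      (forall z, ball_singularity k r z -> singularity R n l (h z) /\ g (h z) = z),
      (forall z, ball_singularity l r z -> singularity R n k (g z)) &
      path_lipschitz (@ball_singularity n k r) K h /\
      path_lipschitz (@ball_singularity n l r) K g].
Proof.
case=> U [V [h [g [[U0 V0] [hXY gYX [hK gK] _ _] h0 hL gL]]]].
have [rU rU0 rUP] := open_nbhs0_ball U0; have [rV rV0 rVP] := open_nbhs0_ball V0.
have [Kh KhP] := inner_lipschitz_path hL; have [Kg KgP] := inner_lipschitz_path gL.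
exists (@unrealify _ \o h \o @realify R _), (@unrealify _ \o g \o @realify R _).
pose r := Num.min 1 (Num.min rU rV); exists r.
have rr : r <= rU /\ r <= rV by rewrite /r !ge_min !lexx !orbT.
pose K := Num.max 1 (Num.max Kh Kg); exists K.
have KK : Kh <= K /\ Kg <= K by rewrite /K !le_max !lexx !orbT.
have inX z : ball_singularity k r z -> (real_singularity R n k `&` U)%classic (realify z).
  by case=> zk zr; split; [exists z|apply: rUP; apply: lt_le_trans zr rr.1].
have inY z : ball_singularity l r z -> (real_singularity R n l `&` V)%classic (realify z).
  by case=> zk zr; split; [exists z|apply: rVP; apply: lt_le_trans zr rr.2].
split.
- by rewrite /r /K !lt_min !ltr01 rU0 rV0 ge_min le_max !lexx.
- rewrite /= realify0 h0 -(realify0 n.+1); exact: realifyK.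
- move=> z /inX zX; split.
    have [[w wl wE] _] := hXY _ zX.
    by rewrite /= -wE realifyK.
  by rewrite /= unrealifyK hK ?realifyK //; exact/mem_set.
- move=> z /inY zX.
  have [[w wl wE] _] := gYX _ zX.
  by rewrite /= -wE realifyK.
- split=> c L L0 cL.
    apply: le_trans (KhP _ inX c L L0 cL) _.
    by rewrite ler_wpM2r ?KK.1.
  apply: le_trans (KgP _ inY c L L0 cL) _.
  by rewrite ler_wpM2r ?KK.2.
Qed.

End CNorm.

(** * Unit vectors and isotropic directions *)

Section Vectors.
Variable R : realType.
Local Notation C := R[i]%C.

Lemma enorm_ge0 m (v : 'rV[R]_m) : 0 <= enorm v.
Proof. exact: sqrtr_ge0. Qed.

Lemma enorm_sqr m (v : 'rV[R]_m) : enorm v ^+ 2 = \sum_i v 0 i ^+ 2.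
Proof. by rewrite sqr_sqrtr // sumr_ge0 // => i _; apply: sqr_ge0. Qed.

(** The difference of the squared norms factors coordinate by coordinate; then
    divide by the sum of the norms. *)
Lemma enorm_dist m (a b : 'rV[R]_m) (d : R) : 0 < enorm a ->
  (forall i, `|a 0 i - b 0 i| <= d) -> `|enorm a - enorm b| <= m%:R * d.
Proof.
move=> a0 abd.
have s0 : 0 < enorm a + enorm b by rewrite ltr_wpDr ?enorm_ge0.
rewrite -(ler_pM2r s0) -[X in _ * X <= _]gtr0_norm // -normrM -subr_sqr !enorm_sqr -sumrB.
apply: le_trans (ler_norm_sum _ _ _) _.
apply: (@le_trans _ _ (\sum_(i < m) d * (enorm a + enorm b))).
  apply: ler_sum => i _; rewrite subr_sqr normrM.
  apply: ler_pM => //; apply: le_trans (ler_normD _ _) _.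
  by rewrite lerD // coord_le_enorm.
by rewrite big_const_ord iter_addr_0 -mulrA mulr_natl.
Qed.

Definition unitv m (v : 'rV[R]_m) : 'rV[R]_m := (enorm v)^-1 *: v.

Lemma enormZ m (a : R) (v : 'rV[R]_m) : enorm (a *: v) = `|a| * enorm v.
Proof.
rewrite /enorm -sqrtr_sqr -sqrtrM ?sqr_ge0 // mulr_sumr; congr Num.sqrt.
by apply: eq_bigr => i _; rewrite mxE exprMn.
Qed.

Lemma enorm_unitv m (v : 'rV[R]_m) : 0 < enorm v -> enorm (unitv v) = 1.
Proof. by move=> v0; rewrite enormZ ger0_norm ?invr_ge0 ?ltW // mulVf ?gt_eqF. Qed.

Lemma unitv_lipschitz m (a b : 'rV[R]_m) (d : R) : 0 < enorm a -> 0 < enorm b ->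
  (forall i, `|a 0 i - b 0 i| <= d) ->
  forall i, `|unitv a 0 i - unitv b 0 i| <= m.+1%:R * d / enorm a.
Proof.
move=> a0 b0 abd i; rewrite !mxE.
have -> : (enorm a)^-1 * a 0 i - (enorm b)^-1 * b 0 i =
   (a 0 i - b 0 i) / enorm a + (b 0 i / enorm b) * ((enorm b - enorm a) / enorm a).
  by field; rewrite !gt_eqF.
apply: le_trans (ler_normD _ _) _; rewrite !normrM.
rewrite -natr1 mulrDl mul1r mulrDl addrC.
have ia : 0 < `|(enorm a)^-1| by rewrite normr_gt0 invr_eq0 gt_eqF.
rewrite -[X in _ <= _ * X + _ * X]gtr0_norm ?invr_gt0 //.
apply: lerD; last by rewrite ler_pM2r.
apply: (@le_trans _ _ (1 * (`|enorm b - enorm a| * `|(enorm a)^-1|))).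
  apply: ler_wpM2r; first by rewrite mulr_ge0.
  by rewrite -normrM normrM normfV ler_pdivrMr ?normr_gt0 ?gt_eqF // mul1r
     [leRHS]gtr0_norm // coord_le_enorm.
by rewrite mul1r ler_pM2r // distrC enorm_dist.
Qed.

Lemma norm_pow_diff (x y : C) (B : R) k : normc x <= B -> normc y <= B ->
  normc (x ^+ k.+1 - y ^+ k.+1) <= k.+1%:R * B ^+ k * normc (x - y).
Proof.
move=> xB yB; have B0 : 0 <= B by apply: le_trans xB; apply: normc_ge0.
elim: k => [|k IH]; first by rewrite !expr1 expr0 !mul1r.
have -> : x ^+ k.+2 - y ^+ k.+2 = x * (x ^+ k.+1 - y ^+ k.+1) + (x - y) * y ^+ k.+1.
  by rewrite ![_ ^+ k.+2]exprS; ring.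
apply: le_trans (normcD _ _) _; rewrite !normcM.
have -> : k.+2%:R * B ^+ k.+1 * normc (x - y) =
  B * (k.+1%:R * B ^+ k * normc (x - y)) + normc (x - y) * B ^+ k.+1.
  by rewrite exprS -[k.+2%:R]natr1; ring.
apply: lerD; first by apply: ler_pM; rewrite ?normc_ge0.
by apply: ler_wpM2l; rewrite ?normc_ge0 // normcX lerXn2r ?nnegrE ?normc_ge0.
Qed.

(** The vector nu has two nonzero coordinates, 1 at some place i <> j and e at
    place j, with e a square root of -1. As
    (z_i + e z_j) - (z_i - e z_j) = 2 e z_j, one of the two choices of e makes
    the product with z at least as large as z_j. *)
Lemma isotropic_direction n (z : 'I_n -> C) (M : R) (j : 'I_n) : (1 < n)%N ->
  normc (z j) = M ->
  exists nu : 'I_n -> C,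
  [/\ \sum_m nu m ^+ 2 = 0, forall m, normc (nu m) <= 1,
      M <= normc (\sum_m z m * nu m) &
      forall (x : 'I_n -> C) (d : R), (forall m, normc (x m) <= d) ->
        normc (\sum_m x m * nu m) <= 2 * d].
Proof.
move=> n1 zM.
have [i ij] : exists i : 'I_n, i != j.
  pose i0 := Ordinal (ltnW n1); pose i1 := Ordinal n1.
  by have [j0|] := eqVneq i0 j; [exists i1; rewrite -j0|exists i0].
pose nu (e : C) (m : 'I_n) : C := if m == i then 1 else if m == j then e else 0.
have sumnu (F : 'I_n -> C) : (forall m, m != i -> m != j -> F m = 0) ->
    \sum_m F m = F i + F j.
  move=> F0; rewrite (bigD1 i) //= (bigD1 j) ?(eq_sym j) //= [X in _ + (_ + X)]big1 ?addr0 //.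
  by move=> m /andP[mi mj]; exact: F0.
have nuE e (x : 'I_n -> C) : \sum_m x m * nu e m = x i + x j * e.
  rewrite sumnu // /nu ?eqxx ?mulr1 ?(eq_sym j) ?(negPf ij) //.
  by move=> m /negPf -> /negPf ->; rewrite mulr0.
suff [e e2 [eN zM']] : exists2 e : C, e ^+ 2 = -1 & normc e = 1 /\ M <= normc (z i + z j * e).
  exists (nu e); split.
  - rewrite sumnu /nu ?eqxx ?(eq_sym j) ?(negPf ij) ?e2 ?expr1n ?subrr //.
    by move=> m /negPf -> /negPf ->; rewrite expr0n.
  - by move=> m; rewrite /nu; case: ifP => _; [|case: ifP => _]; rewrite ?normc1 ?eN ?normc0.
  - by rewrite nuE.
  - move=> x d xd; rewrite nuE; apply: le_trans (normcD _ _) _.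
    by rewrite normcM eN mulr1 mulr_natl mulr2n lerD.
pose I : C := 'i%C.
have I2 : I ^+ 2 = -1 by apply: sqr_i.
have IN : normc I = 1 by rewrite /normc /= expr0n add0r expr1n sqrtr1.
have [Mle|Mlt] := leP M (normc (z i + z j * I)); first by exists I.
exists (- I); first by rewrite sqrrN.
split; first by rewrite -IN; exact: (@normcN R I).
have : 2 * M <= normc (z i + z j * I) + normc (z i + z j * - I).
  have -> : 2 * M = normc (2 * I * z j).
    rewrite !normcM IN mulr1 zM; congr (_ * _).
    by have := normcR (2 : R); rewrite rmorph_nat => ->; rewrite ger0_norm.
  have -> : 2 * I * z j = (z i + z j * I) + - (z i + z j * - I) by ring.
  apply: le_trans (normcD _ _) _; rewrite lerD2l.
  by rewrite -[leLHS](@normcN R) opprK.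
by lra.
Qed.

End Vectors.

(** * Radial paths and local retractions in the singularity *)

Section Singularity.
Variables (R : realType) (n : nat).
Local Notation C := R[i]%C.

Definition zpart (z : 'rV[C]_n.+1) (j : 'I_n) : C := z 0 (widen_ord (leqnSn n) j).
Definition wpart (z : 'rV[C]_n.+1) : C := z 0 ord_max.
Definition zw_point (x : 'I_n -> C) (w : C) : 'rV[C]_n.+1 :=
  \row_i if unlift ord_max i is Some j then x j else w.

Lemma widen_lift (j : 'I_n) : widen_ord (leqnSn n) j = lift ord_max j.
Proof. by apply: val_inj; rewrite [RHS]lift_max. Qed.

Lemma zpart_point x w j : zpart (zw_point x w) j = x j.
Proof. by rewrite /zpart mxE widen_lift liftK. Qed.

Lemma wpart_point x w : wpart (zw_point x w) = w.
Proof. by rewrite /wpart mxE unlift_none. Qed.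

Lemma coordP (P : 'I_n.+1 -> Prop) :
  (forall j : 'I_n, P (widen_ord (leqnSn n) j)) -> P ord_max -> forall i, P i.
Proof.
move=> Pz Pw i; case: (unliftP ord_max i) => [j ->|-> //].
by rewrite -widen_lift.
Qed.

Lemma zw_point_eta z : zw_point (zpart z) (wpart z) = z.
Proof.
apply/rowP; apply: coordP => [j|]; first exact: (zpart_point (zpart z) (wpart z) j).
exact: (wpart_point (zpart z) (wpart z)).
Qed.

Lemma zpart_le z j : normc (zpart z j) <= cnorm z. Proof. exact: normc_le_cnorm. Qed.
Lemma wpart_le z : normc (wpart z) <= cnorm z. Proof. exact: normc_le_cnorm. Qed.

Lemma zpartB z z' j : zpart (z - z') j = zpart z j - zpart z' j.
Proof. by rewrite /zpart !mxE. Qed.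
Lemma wpartB z z' : wpart (z - z') = wpart z - wpart z'.
Proof. by rewrite /wpart !mxE. Qed.

Lemma cnorm_le_parts z (d : R) : 0 <= d -> (forall j, normc (zpart z j) <= d) ->
  normc (wpart z) <= d -> cnorm z <= d.
Proof. by move=> d0 zd wd; apply: cnorm_le => //; apply: coordP. Qed.

Lemma singularityE k z :
  singularity R n k z <-> \sum_j zpart z j ^+ 2 = wpart z ^+ k.
Proof.
rewrite /singularity /=; split => [/eqP|E].
  by rewrite subr_eq0 => /eqP.
by apply/eqP; rewrite subr_eq0 -E.
Qed.

Lemma singularity0 k : (0 < k)%N -> singularity R n k 0.
Proof.
move=> k0; apply/singularityE.
have -> : wpart (0 : 'rV[C]_n.+1) = 0 by rewrite /wpart mxE.
have z0 j : zpart (0 : 'rV[C]_n.+1) j = 0 by rewrite /zpart mxE.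
rewrite expr0n eqn0Ngt k0; apply: big1 => j _.
by rewrite z0 expr0n.
Qed.

Lemma unit_interval_normc (s : R) : 0 <= s <= 1 -> normc (s%:C)%C <= 1.
Proof. by case/andP=> s0 s1; rewrite normcR ger0_norm. Qed.

Lemma pow_unit_lipschitz (s t : R) k : 0 <= s <= 1 -> 0 <= t <= 1 ->
  normc ((s%:C)%C ^+ k.+1 - (t%:C)%C ^+ k.+1) <= k.+1%:R * `|s - t|.
Proof.
move=> /unit_interval_normc s1 /unit_interval_normc t1.
by apply: le_trans (norm_pow_diff k s1 t1) _; rewrite expr1n mulr1 -rmorphB normcR.
Qed.

(** By weighted homogeneity the path s |-> (s^k z, s^2 w) stays in the
    singularity. It joins the origin to (z, w) and has a Lipschitz constant of
    the order of the norm of (z, w). *)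
Lemma radial_lipschitz p k (r K : R) (f : 'rV[C]_n.+1 -> 'rV[C]_p) z : (1 < k)%N ->
  path_lipschitz (ball_singularity k r) K f -> ball_singularity k r z ->
  cnorm (f z - f 0) <= K * (k%:R * cnorm z).
Proof.
move=> k1 fK [zk zr].
pose c (s : R) := zw_point (fun j => (s%:C)%C ^+ k * zpart z j) ((s%:C)%C ^+ 2 * wpart z).
have c0 : c 0 = 0.
  apply/rowP; apply: coordP => [j|]; rewrite [RHS]mxE.
    by rewrite -[LHS]/(zpart (c 0) j) zpart_point expr0n gtn_eqF ?mul0r // ltnW.
  by rewrite -[LHS]/(wpart (c 0)) wpart_point expr0n mul0r.
have c1 : c 1 = z.
  rewrite -[RHS]zw_point_eta; apply/rowP => i; rewrite !mxE.
  by case: unlift => [j|]; rewrite expr1n mul1r.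
rewrite -c0 -{1}c1 cnormB; apply: fK; first by rewrite mulr_ge0 ?cnorm_ge0.
split=> [s s01|s t s01 t01].
  have le1 m x : normc ((s%:C)%C ^+ m * x) <= normc x.
    rewrite normcM normcX ler_piMl ?normc_ge0 // exprn_ile1 ?normc_ge0 //.
    exact: unit_interval_normc.
  split; last first.
    apply: le_lt_trans zr; apply: cnorm_le_parts; rewrite ?cnorm_ge0 //.
      by move=> j; rewrite zpart_point (le_trans (le1 _ _)) // zpart_le.
    by rewrite wpart_point (le_trans (le1 _ _)) // wpart_le.
  apply/singularityE; rewrite wpart_point exprMn -exprM mulnC exprM.
  under eq_bigr do rewrite zpart_point exprMn.
  rewrite -mulr_sumr; congr (_ * _); exact/singularityE.
have k0 : 0 <= k%:R * cnorm z * `|s - t| by rewrite !mulr_ge0 ?cnorm_ge0.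
apply: cnorm_le_parts => // [j|].
  rewrite zpartB !zpart_point -mulrBl normcM mulrAC ler_pM ?normc_ge0 ?zpart_le //.
  by rewrite -(prednK (ltnW k1)) pow_unit_lipschitz.
rewrite wpartB !wpart_point -mulrBl normcM mulrAC ler_pM ?normc_ge0 ?wpart_le //.
apply: le_trans (pow_unit_lipschitz 1 s01 t01) _.
by rewrite ler_wpM2r // ler_nat.
Qed.

Lemma wpart_pow_le l (q : 'rV[C]_n.+1) (M : R) : singularity R n l q -> 0 <= M ->
  (forall j, normc (zpart q j) <= M) -> normc (wpart q) ^+ l <= n%:R * M ^+ 2.
Proof.
move=> ql M0 qM; move/singularityE: ql; rewrite -normcX => <-.
apply: le_trans (normc_sum _ _ _) _.
apply: (@le_trans _ _ (\sum_(i < n) M ^+ 2)).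
  by apply: ler_sum => i _; rewrite normcX ler_sqr ?nnegrE ?normc_ge0 ?qM.
by rewrite big_const_ord iter_addr_0 mulr_natl.
Qed.

(** The retraction moves a point (z, w) to (z + lam nu, w) for an isotropic
    vector nu. Since nu . nu = 0, the equation of the singularity is linear in
    lam, with solution lam = (w^l - z . z) / (2 z . nu). By the choice of nu
    the denominator is of size M on the whole ball, and its numerator is
    Lipschitz with a constant of the order of M: this is clear for z . z, and
    the derivative of w^l has size |w|^(l-1), where |w|^l <= n M^2 and
    l - 1 >= l / 2. *)
Lemma local_retraction l : (1 < n)%N -> (1 < l)%N -> exists2 K : R, 0 <= K &
  forall (q : 'rV[C]_n.+1) (M eps : R) (j0 : 'I_n), singularity R n l q ->
  normc (zpart q j0) = M -> (forall j, normc (zpart q j) <= M) ->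
  0 < M <= 1 -> normc (wpart q) <= 1 -> 0 <= eps -> 4 * eps <= M ->
  exists pi : 'rV[C]_n.+1 -> 'rV[C]_n.+1,
  [/\ forall p, cnorm (p - q) <= eps -> singularity R n l (pi p),
      forall p, singularity R n l p -> pi p = p &
      forall p p', cnorm (p - q) <= eps -> cnorm (p' - q) <= eps ->
        cnorm (pi p - pi p') <= K * cnorm (p - p')].
Proof.
move=> n1 l1; pose A : R := l%:R * 2 ^+ l * n.+1%:R + 4 * n%:R.
have A0 : 0 <= A by rewrite addr_ge0 ?mulr_ge0 ?exprn_ge0.
exists (1 + 2 * A) => [|q M eps j0]; first by rewrite addr_ge0 ?mulr_ge0.
move=> ql qj qM /andP[M0 M1] w1 eps0 epsM; have M0' := ltW M0.
have [nu [nu2 nu1 bq nuB]] := isotropic_direction n1 qj.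
pose b p := \sum_m zpart p m * nu m.
pose num p := wpart p ^+ l - \sum_m zpart p m ^+ 2.
pose lam p := num p / (2 * b p).
pose pi p := zw_point (fun m => zpart p m + lam p * nu m) (wpart p).
have bB p p' : normc (b p - b p') <= 2 * cnorm (p - p').
  rewrite /b -sumrB; under eq_bigr do rewrite -mulrBl -zpartB.
  by apply: nuB => m; apply: zpart_le.
have two : normc (2 : C) = 2.
  by have := normcR (2 : R); rewrite rmorph_nat => ->; rewrite ger0_norm.
have den p : cnorm (p - q) <= eps -> M <= normc (2 * b p).
  move=> pq; rewrite normcM two.
  have := bB q p; rewrite cnormB => bqp.
  have : normc (b q) <= normc (b q - b p) + normc (b p).
    by apply: le_trans (normcD _ _); rewrite subrK.
  by move: bq; rewrite -/(b q); lra.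
have den0 p : cnorm (p - q) <= eps -> 2 * b p != 0.
  by move=> pq; apply/eqP => E; have := den _ pq; rewrite E normc0; lra.
pose B := normc (wpart q) + eps.
(* Squaring reduces this to the equation of the singularity, as 2 (l - 1) >= l
   and |w| <= 1 at q. *)
have wM : normc (wpart q) ^+ l.-1 <= n%:R * M.
  have sq := wpart_pow_le ql M0' qM.
  rewrite -ler_sqr ?nnegrE ?exprn_ge0 ?mulr_ge0 ?normc_ge0 //.
  apply: (@le_trans _ _ (n%:R * M ^+ 2)).
    apply: (le_trans _ sq); rewrite -exprM;
    apply: ler_wiXn2l; rewrite ?normc_ge0 //; move: (l1); clear; lia.
  rewrite exprMn; apply: ler_wpM2r; first by rewrite sqr_ge0.
  by rewrite -natrX ler_nat leq_pmulr // ltnW.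
have BM : B ^+ l.-1 <= 2 ^+ l * n.+1%:R * M.
  suff bound x : 0 <= x -> B <= 2 * x -> x ^+ l.-1 <= n.+1%:R * M ->
      B ^+ l.-1 <= 2 ^+ l * n.+1%:R * M.
    have [we|we] := leP (normc (wpart q)) eps.
      apply: (bound eps) => //; first by rewrite /B; lra.
      apply: (@le_trans _ _ (eps ^+ 1)).
        by apply: ler_wiXn2l => //; [lra|move: (l1); clear; lia].
      rewrite expr1; apply: (@le_trans _ _ (1 * M)); first lra.
      by rewrite ler_pM2r // ler1n.
    apply: (bound (normc (wpart q))); rewrite ?normc_ge0 //; first by rewrite /B; lra.
    apply: le_trans wM _; rewrite ler_pM2r // ler_nat //.
  move=> x0 Bx xM.
  apply: (@le_trans _ _ ((2 * x) ^+ l.-1)).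
    by apply: lerXn2r; rewrite ?nnegrE ?addr_ge0 ?normc_ge0 ?mulr_ge0.
  rewrite exprMn -mulrA; apply: ler_pM; rewrite ?exprn_ge0 //.
  by apply: ler_weXn2l; rewrite ?leq_pred // ler1n.
have numB p p' : cnorm (p - q) <= eps -> cnorm (p' - q) <= eps ->
    normc (num p - num p') <= A * M * cnorm (p - p').
  move=> pq p'q; set d := cnorm _.
  have wB r : cnorm (r - q) <= eps -> normc (wpart r) <= B.
    move=> rq; rewrite -[r](subrK q) /wpart mxE (le_trans (normcD _ _)) // /B addrC lerD2l.
    exact: le_trans (wpart_le _) rq.
  have zB r m : cnorm (r - q) <= eps -> normc (zpart r m) <= 2 * M.
    move=> rq; rewrite -[r](subrK q) /zpart mxE (le_trans (normcD _ _)) //.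
    have := le_trans (zpart_le (r - q) m) rq; have := qM m; rewrite /zpart; lra.
  have -> : num p - num p' = (wpart p ^+ l - wpart p' ^+ l)
      + \sum_m (zpart p' m - zpart p m) * (zpart p' m + zpart p m).
    under eq_bigr do rewrite -subr_sqr.
    by rewrite sumrB /num; ring.
  apply: le_trans (normcD _ _) _.
  rewrite /A !mulrDl; apply: lerD.
    rewrite -(prednK (ltnW l1)).
    apply: le_trans (norm_pow_diff _ (wB _ pq) (wB _ p'q)) _.
    rewrite (prednK (ltnW l1)) -wpartB.
    apply: ler_pM; rewrite ?normc_ge0 ?wpart_le ?mulr_ge0 ?exprn_ge0 ?addr_ge0 ?normc_ge0 //.
    by rewrite -!mulrA ler_wpM2l // mulrA.
  apply: le_trans (normc_sum _ _ _) _.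
  apply: (@le_trans _ _ (\sum_(i < n) (d * (4 * M)))).
    apply: ler_sum => m _; rewrite normcM; apply: ler_pM; rewrite ?normc_ge0 //.
      by rewrite normcB -zpartB; apply: zpart_le.
    apply: le_trans (normcD _ _) _.
    have := zB _ m pq; have := zB _ m p'q; lra.
  rewrite big_const_ord iter_addr_0 -mulr_natl le_eqVlt; apply/orP; left; apply/eqP; ring.
have numq : num q = 0 by apply/eqP; rewrite subr_eq0; apply/eqP/esym/singularityE.
have lamB p p' : cnorm (p - q) <= eps -> cnorm (p' - q) <= eps ->
    normc (lam p - lam p') <= 2 * A * cnorm (p - p').
  move=> pq p'q; have Dp := den _ pq; have Dp' := den _ p'q.
  have -> : lam p - lam p' = ((num p - num p') * (2 * b p')
      + num p' * (2 * b p' - 2 * b p)) / ((2 * b p) * (2 * b p')).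
    rewrite /lam; have := den0 _ pq; have := den0 _ p'q.
    move: (2 * b p) (2 * b p') => x y y0 x0; field.
    by rewrite x0 y0.
  rewrite normcM normcV ler_pdivrMr; last first.
    by rewrite normcM mulr_gt0 // (lt_le_trans M0).
  apply: le_trans (normcD _ _) _; rewrite !normcM -mulrBr normcM two.
  rewrite !normcM two in Dp Dp'.
  set d := cnorm _; have d0 : 0 <= d by apply: cnorm_ge0.
  set x := normc (b p) in Dp *; set y := normc (b p') in Dp' *.
  have -> : 2 * A * d * (2 * x * (2 * y)) =
     A * d * (2 * x * (2 * y)) + A * d * (2 * x * (2 * y)) by ring.
  apply: lerD.
    apply: (@le_trans _ _ (A * M * d * (2 * y))).
      apply: ler_wpM2r; first lra.
      exact: numB.
    rewrite (_ : A * M * d * (2 * y) = A * d * (M * (2 * y))); last by ring.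
    by apply: ler_wpM2l; [rewrite mulr_ge0|apply: ler_wpM2r; lra].
  apply: (@le_trans _ _ (A * M * eps * (2 * (2 * d)))).
    apply: ler_pM; rewrite ?mulr_ge0 ?normc_ge0 //.
      have := numB _ _ p'q (_ : cnorm (q - q) <= eps).
      rewrite numq subr0 => /(_ _)/le_trans; apply.
        by rewrite subrr cnorm0.
      by apply: ler_wpM2l; rewrite ?mulr_ge0 // ltW.
    by rewrite ler_pM2l // normcB bB.
  rewrite (_ : A * M * eps * (2 * (2 * d)) = A * d * (M * (4 * eps))); last by ring.
  apply: ler_wpM2l; first by rewrite mulr_ge0.
  by apply: ler_pM; lra.
exists pi; split.
- move=> p pq; apply/singularityE; rewrite wpart_point.
  under eq_bigr do rewrite zpart_point.
  transitivity (\sum_m (zpart p m ^+ 2 + 2 * lam p * (zpart p m * nu m)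
                         + lam p ^+ 2 * nu m ^+ 2)).
    by apply: eq_bigr => m _; ring.
  rewrite !big_split /= -!mulr_sumr nu2 mulr0 addr0 -/(b p).
  have -> : 2 * lam p * b p = num p.
    by rewrite -mulrA mulrCA /lam divfK ?den0.
  by rewrite /num addrC subrK.
- move=> p pl; rewrite /pi -[RHS]zw_point_eta.
  have -> : lam p = 0.
    rewrite /lam; suff -> : num p = 0 by rewrite mul0r.
    by apply/eqP; rewrite subr_eq0; apply/eqP/esym/singularityE.
  by apply/rowP => i; rewrite !mxE; case: unlift => [j|//]; rewrite mul0r addr0.
- move=> p p' pq p'q.
  have A1 : 0 <= (1 + 2 * A) * cnorm (p - p').
    by rewrite mulr_ge0 ?cnorm_ge0 // addr_ge0 ?mulr_ge0.
  apply: cnorm_le_parts => // [j|].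
    rewrite zpartB !zpart_point opprD addrACA -mulrBl.
    apply: le_trans (normcD _ _) _; rewrite [leRHS]mulrDl mul1r.
    apply: lerD; first by rewrite -zpartB zpart_le.
    rewrite normcM -[leRHS]mulr1; apply: ler_pM; rewrite ?normc_ge0 ?nu1 //.
    exact: lamB.
  rewrite wpartB !wpart_point -wpartB (le_trans (wpart_le _)) //.
  by rewrite ler_peMl ?cnorm_ge0 // lerDl mulr_ge0.
Qed.

End Singularity.

(** * Size of the vanishing spheres *)

Section VanishingSphere.
Variables (R : realType) (n : nat).
Local Notation C := R[i]%C.

(** The sphere of radius s^(k/2) over w = s, with s = t^2 so that all exponents
    are integers. *)
Definition vsphere k (t : R) (u : 'rV[R]_n) : 'rV[C]_n.+1 :=
  zw_point (fun j => (t ^+ k * u 0 j)%:C)%C (t ^+ 2)%:C%C.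

Lemma vsphere_singularity k t u : enorm u = 1 -> singularity R n k (vsphere k t u).
Proof.
move=> u1; apply/singularityE; rewrite wpart_point.
under eq_bigr do rewrite zpart_point -rmorphXn exprMn.
by rewrite -rmorph_sum -mulr_sumr -enorm_sqr u1 expr1n mulr1 -rmorphXn -!exprM mulnC.
Qed.

Lemma unit_coord (u : 'rV[R]_n) i : enorm u = 1 -> `|u 0 i| <= 1.
Proof. by move=> <-; exact: coord_le_enorm. Qed.

Lemma cnorm_vsphere k t u : (1 < k)%N -> 0 <= t <= 1 -> enorm u = 1 ->
  cnorm (vsphere k t u) <= t ^+ 2.
Proof.
move=> k1 /andP[t0 t1] u1; apply: cnorm_le_parts => [|j|]; first exact: sqr_ge0.
  rewrite zpart_point normcR normrM ger0_norm ?exprn_ge0 // -[leRHS]mulr1.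
  by apply: ler_pM; rewrite ?exprn_ge0 ?unit_coord // ler_wiXn2l.
by rewrite wpart_point normcR ger0_norm ?exprn_ge0.
Qed.

Lemma vsphere_ball k t r u : (1 < k)%N -> 0 <= t <= 1 -> t ^+ 2 < r -> enorm u = 1 ->
  ball_singularity k r (vsphere k t u).
Proof.
move=> k1 t01 tr u1; split; first exact: vsphere_singularity.
exact: le_lt_trans (cnorm_vsphere k1 t01 u1) tr.
Qed.

Definition dot (u v : 'rV[R]_n) : R := \sum_i u 0 i * v 0 i.

Lemma dotC u v : dot u v = dot v u.
Proof. by apply: eq_bigr => i _; rewrite mulrC. Qed.

Lemma dot_delta u i : dot u (delta_mx 0 i) = u 0 i.
Proof.
rewrite /dot (bigD1 i) //= mxE !eqxx mulr1 big1 ?addr0 // => j ji.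
by rewrite mxE (negPf ji) mulr0.
Qed.

Lemma dotN u v : dot u (- v) = - dot u v.
Proof. by rewrite /dot -sumrN; apply: eq_bigr => i _; rewrite mxE mulrN. Qed.

Lemma enorm_comb (u v : 'rV[R]_n) a b :
  enorm (a *: u + b *: v) ^+ 2 =
    a ^+ 2 * enorm u ^+ 2 + b ^+ 2 * enorm v ^+ 2 + 2 * a * b * dot u v.
Proof.
rewrite !enorm_sqr /dot !mulr_sumr -!big_split; apply: eq_bigr => i _.
by rewrite !mxE /=; ring.
Qed.

Lemma enorm_delta i : enorm (delta_mx 0 i : 'rV[R]_n) = 1.
Proof.
apply: (@pexpIrn _ 2%N); rewrite ?nnegrE ?enorm_ge0 // enorm_sqr expr1n.
transitivity (dot (delta_mx 0 i) (delta_mx 0 i)); first by apply: eq_bigr.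
by rewrite dot_delta mxE !eqxx.
Qed.

Lemma enormN (u : 'rV[R]_n) : enorm (- u) = enorm u.
Proof. by rewrite -scaleN1r enormZ normrN1 mul1r. Qed.

Lemma unitv_id (u : 'rV[R]_n) : enorm u = 1 -> unitv u = u.
Proof. by move=> u1; rewrite /unitv u1 invr1 scale1r. Qed.

Lemma enorm_gt0 (u : 'rV[R]_n) : u != 0 -> 0 < enorm u.
Proof.
move=> u0; rewrite lt_neqAle enorm_ge0 andbT eq_sym; apply: contra u0 => /eqP E.
apply/eqP/rowP => i; rewrite mxE; apply/eqP; rewrite -normr_le0 -E.
exact: coord_le_enorm.
Qed.

Lemma rV_coord_le_norm (v : 'rV[R]_n) i : `|v 0 i| <= `|v|.
Proof.
rewrite [leRHS]/Num.norm /= mx_normrE.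
exact: (@le_bigmax _ _ _ 0 (fun ij : 'I_1 * 'I_n => `|v ij.1 ij.2|) (0, i)).
Qed.

Lemma rV_norm_le_enorm (v : 'rV[R]_n) : `|v| <= enorm v.
Proof. by apply: rV_norm_le => [|i]; [exact: enorm_ge0|exact: coord_le_enorm]. Qed.

Section Sphere.
Variables (p k : nat) (t r K : R) (f : 'rV[C]_n.+1 -> 'rV[C]_p).
Hypotheses (k1 : (1 < k)%N) (t01 : 0 <= t <= 1) (tr : t ^+ 2 < r) (K0 : 0 <= K).
Hypothesis fK : path_lipschitz (@ball_singularity R n k r) K f.

(** The arc is the normalized segment from u to v. The segment keeps away from
    the origin because the angle is at most a right angle. *)
Lemma sphere_arc u v (d : R) : enorm u = 1 -> enorm v = 1 -> 0 <= dot u v ->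
  (forall i, `|u 0 i - v 0 i| <= d) -> 0 <= d ->
  cnorm (f (vsphere k t u) - f (vsphere k t v)) <= K * (2 * n.+1%:R * d * t ^+ k).
Proof.
move=> u1 v1 uv uvd d0.
pose sg s := (1 - s) *: u + s *: v.
have sg_half s : 0 <= s <= 1 -> 1 / 2 <= enorm (sg s).
  case/andP=> s0 s1.
  rewrite -ler_sqr ?nnegrE ?enorm_ge0 ?divr_ge0 // enorm_comb u1 v1.
  have : 0 <= 2 * (1 - s) * s * dot u v by rewrite !mulr_ge0 // subr_ge0.
  have : 0 <= (2 * s - 1) ^+ 2 by apply: sqr_ge0.
  by rewrite !expr2; nra.
have sg0 s : 0 <= s <= 1 -> 0 < enorm (sg s).
  by move=> /sg_half; apply: lt_le_trans; rewrite divr_gt0.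
pose c s := vsphere k t (unitv (sg s)).
have -> : vsphere k t u = c 0 by rewrite /c /sg subr0 scale1r scale0r addr0 unitv_id.
have -> : vsphere k t v = c 1 by rewrite /c /sg subrr scale1r scale0r add0r unitv_id.
have t0 : 0 <= t by case/andP: t01.
have bd0 : 0 <= 2 * n.+1%:R * d * t ^+ k by rewrite !mulr_ge0 ?exprn_ge0.
apply: fK => //; split=> [s s01|s s' s01 s'01].
  by apply: vsphere_ball => //; apply/enorm_unitv/sg0.
apply: cnorm_le_parts => [|j|]; first by rewrite mulr_ge0.
  rewrite zpartB !zpart_point -rmorphB normcR -mulrBr normrM ger0_norm ?exprn_ge0 //.
  rewrite mulrC [2 * _ * _ * _ * _]mulrAC; apply: ler_wpM2r; first exact: exprn_ge0.
  have sgd i : `|sg s 0 i - sg s' 0 i| <= d * `|s - s'|.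
    have -> : sg s 0 i - sg s' 0 i = (s - s') * (v 0 i - u 0 i).
      by rewrite !mxE; ring.
    by rewrite normrM mulrC ler_wpM2r // distrC.
  apply: le_trans (unitv_lipschitz (sg0 _ s01) (sg0 _ s'01) sgd j) _.
  rewrite ler_pdivrMr ?sg0 //.
  have -> : 2 * n.+1%:R * d * `|s - s'| * enorm (sg s) =
    n.+1%:R * (d * `|s - s'|) * (2 * enorm (sg s)) by ring.
  rewrite -[leLHS]mulr1; apply: ler_wpM2l; first by rewrite !mulr_ge0.
  by have := sg_half _ s01; lra.
by rewrite wpartB !wpart_point subrr normc0 mulr_ge0.
Qed.

(** Each point is joined to the base point e0 by at most three arcs of at most
    a right angle; a point in the opposite half sphere goes through - e0 and
    e1, for which a second dimension is required. *)
Lemma sphere_diameter u v : (1 < n)%N -> enorm u = 1 -> enorm v = 1 ->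
  cnorm (f (vsphere k t u) - f (vsphere k t v)) <= 24 * n.+1%:R * K * t ^+ k.
Proof.
move=> n1.
pose e := 4 * n.+1%:R * K * t ^+ k.
have near x y : enorm x = 1 -> enorm y = 1 -> 0 <= dot x y ->
    cnorm (f (vsphere k t x) - f (vsphere k t y)) <= e.
  move=> x1 y1 xy; apply: le_trans (sphere_arc x1 y1 xy (_ : forall i, _ <= 2) _) _ => //.
    move=> i; apply: le_trans (ler_normB _ _) _.
    by have := unit_coord i x1; have := unit_coord i y1; lra.
  by rewrite /e le_eqVlt; apply/orP; left; apply/eqP; ring.
pose i0 := Ordinal (ltnW n1); pose i1 := Ordinal n1.
pose e0 : 'rV[R]_n := delta_mx 0 i0; pose e1 : 'rV[R]_n := delta_mx 0 i1.
have e0n : enorm e0 = 1 := enorm_delta i0; have e1n : enorm e1 = 1 := enorm_delta i1.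
have ee : dot e1 e0 = 0 by rewrite dot_delta mxE.
have base x : enorm x = 1 -> cnorm (f (vsphere k t x) - f (vsphere k t e0)) <= 3 * e.
  move=> x1; have ege0 : 0 <= e by rewrite !mulr_ge0 ?exprn_ge0 //; case/andP: t01.
  have [x0|x0] := leP 0 (x 0 i0).
    apply: (@le_trans _ _ e); last by lra.
    by apply: near; rewrite ?dot_delta.
  have a1 := near x (- e0) x1 (etrans (enormN _) e0n).
  have a2 := near (- e0) e1 (etrans (enormN _) e0n) e1n.
  have a3 := near e1 e0 e1n e0n.
  have {}a1 := a1 _; have {}a2 := a2 _.
  apply: le_trans (cnorm_triangle _ (f (vsphere k t (- e0))) _) _.
  have := cnorm_triangle (f (vsphere k t (- e0))) (f (vsphere k t e1)) (f (vsphere k t e0)).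
  have : 0 <= dot x (- e0) by rewrite dotN dot_delta oppr_ge0 ltW.
  have : 0 <= dot (- e0) e1 by rewrite dotC dotN ee oppr0.
  by rewrite ee in a3; move=> /a2 + /a1; have := a3 (lexx _); lra.
move=> u1 v1; apply: le_trans (cnorm_triangle _ (f (vsphere k t e0)) _) _.
have := base _ u1; have := base _ v1; rewrite [cnorm (f (vsphere k t v) - _)]cnormB /e; lra.
Qed.

(** When the angle is obtuse the arcs are of no use, but then the norm of v is
    bounded by that of u - v, and the diameter of the sphere suffices. *)
Lemma sphere_spread (u v : 'rV[R]_n) (d : R) : (1 < n)%N -> u != 0 -> v != 0 -> 0 <= d ->
  (forall i, `|u 0 i - v 0 i| <= d) ->
  `|v| * cnorm (f (vsphere k t (unitv u)) - f (vsphere k t (unitv v)))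
     <= (n%:R * (24 * n.+1%:R * K * t ^+ k) + K * (2 * n.+1%:R * n.+1%:R * t ^+ k)) * d.
Proof.
move=> n1 u0 v0 d0 uvd; have pu := enorm_gt0 u0; have pv := enorm_gt0 v0.
have u1 := enorm_unitv pu; have v1 := enorm_unitv pv.
have t0 : 0 <= t by case/andP: t01.
have c1 : 0 <= n%:R * (24 * n.+1%:R * K * t ^+ k) * d by rewrite !mulr_ge0 ?exprn_ge0.
have c2 : 0 <= K * (2 * n.+1%:R * n.+1%:R * t ^+ k) * d by rewrite !mulr_ge0 ?exprn_ge0.
rewrite mulrDl.
have [uv|uv] := leP 0 (dot (unitv u) (unitv v)).
  apply: (@le_trans _ _ (K * (2 * n.+1%:R * n.+1%:R * t ^+ k) * d)); last by rewrite lerDr.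
  have vud i : `|v 0 i - u 0 i| <= d by rewrite distrC.
  have := sphere_arc u1 v1 uv _ _.
  move=> /(_ (n.+1%:R * d / enorm v)) arc.
  apply: (@le_trans _ _ (enorm v * (K * (2 * n.+1%:R * (n.+1%:R * d / enorm v) * t ^+ k)))).
    apply: ler_pM; rewrite ?cnorm_ge0 ?rV_norm_le_enorm //.
    apply: arc => [i|]; last by rewrite divr_ge0 ?mulr_ge0 // ltW.
    by rewrite distrC; apply: unitv_lipschitz.
  by rewrite le_eqVlt; apply/orP; left; apply/eqP; field; rewrite gt_eqF.
apply: (@le_trans _ _ (n%:R * (24 * n.+1%:R * K * t ^+ k) * d)); last by rewrite lerDl.
rewrite mulrAC; apply: ler_pM; rewrite ?cnorm_ge0 ?sphere_diameter //.
apply: le_trans (rV_norm_le_enorm _) _.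
have dv : dot u v < 0.
  move: uv; rewrite /unitv /dot.
  under eq_bigr do rewrite !mxE mulrACA.
  by rewrite -mulr_sumr pmulr_rlt0 // mulr_gt0 ?invr_gt0.
apply: (@le_trans _ _ (enorm (1 *: u + (-1) *: v))).
  rewrite -ler_sqr ?nnegrE ?enorm_ge0 // enorm_comb.
  by have := sqr_ge0 (enorm u); lra.
rewrite scale1r scaleN1r; apply: enorm_le_coord => // i.
by rewrite !mxE.
Qed.

End Sphere.
End VanishingSphere.

(** * The vanishing spheres are essential *)

Section Essential.
Variables (R : realType) (n : nat).
Local Notation C := R[i]%C.

Lemma Re_sqr (x : C) : complex.Re (x ^+ 2) <= complex.Re x ^+ 2.
Proof. by case: x => a b; rewrite /= gerBl -expr2 sqr_ge0. Qed.

Lemma Re_pow_near (w : C) (a : R) k : 0 < a ->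
  normc (w - a%:C%C) <= a / (k.+1%:R * 2 ^+ k.+1) -> a ^+ k.+1 / 2 <= complex.Re (w ^+ k.+1).
Proof.
move=> a0 wa.
have k0 : 0 < k.+1%:R * 2 ^+ k.+1 :> R by rewrite mulr_gt0 ?exprn_gt0.
have aN : normc (a%:C)%C = a by rewrite normcR gtr0_norm.
have wB : normc w <= 2 * a.
  rewrite -[w](subrK a%:C%C); apply: le_trans (normcD _ _) _; rewrite aN.
  rewrite mulr_natl mulr2n lerD2r; apply: (le_trans wa).
  by rewrite ler_pdivrMr // ler_peMr ?(ltW a0) // mulr_ege1 ?ler1n // exprn_ege1 // ler1n.
have aB : normc (a%:C)%C <= 2 * a by rewrite aN; lra.
have := le_trans (Re_le_normc _) (norm_pow_diff k wB aB).
have -> : complex.Re (w ^+ k.+1 - a%:C%C ^+ k.+1) = complex.Re (w ^+ k.+1) - a ^+ k.+1.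
  by rewrite -rmorphXn; case: (w ^+ k.+1).
suff : k.+1%:R * (2 * a) ^+ k * normc (w - a%:C%C) <= a ^+ k.+1 / 2.
  by move=> le1 /le_trans/(_ le1); rewrite ler_norml => /andP[]; lra.
apply: (@le_trans _ _ (k.+1%:R * (2 * a) ^+ k * (a / (k.+1%:R * 2 ^+ k.+1)))).
  by apply: ler_wpM2l => //; rewrite mulr_ge0 ?exprn_ge0 ?mulr_ge0 // ltW.
rewrite le_eqVlt; apply/orP; left; apply/eqP.
rewrite exprMn [a ^+ k.+1]exprS [2 ^+ k.+1]exprS; field.
by rewrite expf_neq0 ?pnatr_eq0 // addrC natr1 pnatr_eq0.
Qed.

Lemma cube_norm_le (v : 'rV[R]_n) : in_cube v -> `|v| <= 1.
Proof. exact: rV_norm_le. Qed.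

Lemma cube_face_norm (v : 'rV[R]_n) i : in_cube v -> `|v 0 i| = 1 -> `|v| = 1.
Proof.
by move=> vc vi; apply/le_anti; rewrite cube_norm_le //= -vi rV_coord_le_norm.
Qed.

(** On the singularity |Re z|^2 >= Re (z . z) = Re (w^k), which stays away from
    0 when w is close to t^2. So the map v |-> Re z (G v) from the cube to R^n
    has no small values, although on the boundary it is a positive multiple of
    the identity. *)
Lemma sphere_essential k (t : R) (G : 'rV[R]_n -> 'rV[C]_n.+1) (L : R) :
  (0 < k)%N -> 0 < t ->
  (forall v v' (d : R), in_cube v -> in_cube v' -> 0 <= d ->
     (forall i, `|v 0 i - v' 0 i| <= d) -> cnorm (G v - G v') <= L * d) ->
  (forall v, in_cube v -> singularity R n k (G v)) ->
  (forall v, in_cube v ->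
     normc (wpart (G v) - (t ^+ 2)%:C%C) <= t ^+ 2 / (k%:R * 2 ^+ k)) ->
  (forall v, in_cube v -> `|v| = 1 -> G v = vsphere k t (unitv v)) -> False.
Proof.
case: k => // k _ t0 GL Gk Gw Gface.
pose F v : 'rV[R]_n := \row_i complex.Re (zpart (G v) i).
pose rho := (t ^+ 2) ^+ k.+1 / 2.
have rho0 : 0 < rho by rewrite divr_gt0 ?exprn_gt0.
pose eta := Num.min 1 (rho / n.+1%:R).
have eta0 : 0 < eta by rewrite /eta lt_min ltr01 divr_gt0.
have Fface v i : in_cube v -> `|v 0 i| = 1 ->
    F v 0 i = t ^+ k.+1 / enorm v * v 0 i /\ 0 < t ^+ k.+1 / enorm v.
  move=> vc vi.
  have v0 : v != 0.
    by apply/eqP => E; move: vi; rewrite E mxE normr0 => /eqP; rewrite eq_sym oner_eq0.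
  split; last by rewrite divr_gt0 ?exprn_gt0 ?enorm_gt0.
  by rewrite mxE Gface ?zpart_point ?(cube_face_norm vc vi) //= mxE mulrA.
have [| | |v vc vF] := @poincare_miranda _ n F L _ _ _ eta eta0.
- move=> v v' d vc v'c vv' i; rewrite !mxE.
  have d0 := le_trans (normr_ge0 _) (vv' i).
  apply: le_trans (GL _ _ _ vc v'c d0 vv'); apply: le_trans (zpart_le _ i); rewrite zpartB.
  by apply: le_trans (Re_le_normc _); case: (zpart (G v) i) (zpart (G v') i) => [? ?] [? ?].
- move=> v i vc vi; have vi1 : `|v 0 i| = 1 by rewrite vi normrN1.
  by have [-> pos] := Fface _ _ vc vi1; rewrite vi mulrN1 oppr_lt0.
- move=> v i vc vi; have vi1 : `|v 0 i| = 1 by rewrite vi normr1.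
  by have [-> pos] := Fface _ _ vc vi1; rewrite vi mulr1.
have := Re_pow_near (exprn_gt0 2 t0) (Gw _ vc).
have /singularityE <- := Gk _ vc.
rewrite -/rho leNgt => /negP; apply.
have -> : complex.Re (\sum_j zpart (G v) j ^+ 2) = \sum_j complex.Re (zpart (G v) j ^+ 2).
  by apply: (big_morph (@complex.Re R)) => // -[? ?] [? ?].
have eta1 : eta <= 1 by rewrite /eta ge_min lexx.
have etar : eta <= rho / n.+1%:R by rewrite /eta ge_min lexx orbT.
apply: (@le_lt_trans _ _ (\sum_(j < n) eta)).
  apply: ler_sum => j _; apply: le_trans (Re_sqr _) _.
  have := vF j; rewrite mxE => /ltW vj.
  rewrite -real_normK ?num_real // expr2 -[leRHS]mulr1.
  by apply: ler_pM => //; exact: le_trans vj eta1.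
rewrite big_const_ord iter_addr_0 -mulr_natl.
apply: (@lt_le_trans _ _ (n.+1%:R * eta)); first by rewrite ltr_pM2r // ltr_nat.
by move: etar; rewrite ler_pdivlMr // mulrC.
Qed.

Lemma small_parameter (a b c : R) : 0 <= a -> 0 <= b -> 0 <= c ->
  exists t : R, [/\ 0 < t <= 1, a * t <= 1, b * t <= 1 & c * t <= 1].
Proof.
move=> a0 b0 c0; have p : 0 < 1 + a + b + c by lra.
exists (1 + a + b + c)^-1; rewrite !ler_pdivrMr // invr_gt0 p invf_le1 //.
by split; lra.
Qed.

End Essential.

(** * Contracting the image of a sphere *)

Section Contraction.
Variables (R : realType) (n : nat).
Local Notation C := R[i]%C.

Lemma cnormZ m (a : R) (z : 'rV[C]_m) : cnorm (a%:C%C *: z) <= `|a| * cnorm z.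
Proof.
apply: cnorm_le => [|i]; first by rewrite mulr_ge0 ?cnorm_ge0.
by rewrite mxE normcM normcR ler_wpM2l ?normc_le_cnorm.
Qed.

(** Here `|v| is the sup norm: the center of the cube goes to the apex q, and
    each boundary point v goes to the value of phi in the direction of v. *)
Definition cone m (phi : 'rV[R]_n -> 'rV[C]_m) (q : 'rV[C]_m) v : 'rV[C]_m :=
  q + `|v|%:C%C *: (phi (unitv v) - q).

Section Cone.
Variables (m : nat) (phi : 'rV[R]_n -> 'rV[C]_m) (q : 'rV[C]_m) (eps S : R).
Hypotheses (eps0 : 0 <= eps) (S0 : 0 <= S).
Hypothesis phi_eps : forall u, enorm u = 1 -> cnorm (phi u - q) <= eps.
Hypothesis phi_S : forall (u v : 'rV[R]_n) (d : R), u != 0 -> v != 0 -> 0 <= d ->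
  (forall i, `|u 0 i - v 0 i| <= d) ->
  `|v| * cnorm (phi (unitv u) - phi (unitv v)) <= S * d.

Lemma cone_dist v : cnorm (cone phi q v - q) <= `|v| * eps.
Proof.
rewrite /cone addrC addKr; apply: le_trans (cnormZ _ _) _; rewrite normr_id.
have [->|v0] := eqVneq v 0; first by rewrite normr0 !mul0r.
by apply: ler_wpM2l => //; apply/phi_eps/enorm_unitv/enorm_gt0.
Qed.

(** Normalization is not Lipschitz near the center of the cube; the factor
    `|v| compensates for that. *)
Lemma cone_lipschitz (u v : 'rV[R]_n) (d : R) : 0 <= d -> (forall i, `|u 0 i - v 0 i| <= d) ->
  cnorm (cone phi q u - cone phi q v) <= (eps + S) * d.
Proof.
move=> d0 uvd.
have uv : `|u - v| <= d by apply: rV_norm_le => // i; rewrite !mxE.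
have Sd : 0 <= S * d by rewrite mulr_ge0.
rewrite mulrDl.
have [u0|u0] := eqVneq u 0.
  have -> : cone phi q u = q by rewrite /cone u0 normr0 scale0r addr0.
  rewrite cnormB; apply: le_trans (cone_dist _) _.
  apply: (@le_trans _ _ (eps * d)); last by rewrite lerDl.
  by rewrite mulrC ler_wpM2l // -normrN -[- v]add0r -u0.
have -> : cone phi q u - cone phi q v = (`|u| - `|v|)%:C%C *: (phi (unitv u) - q)
   + `|v|%:C%C *: (phi (unitv u) - phi (unitv v)).
  rewrite /cone rmorphB scalerBl opprD addrACA subrr add0r -addrA; congr (_ + _).
  by rewrite -!scalerN -scalerDr; congr (_ *: _); rewrite !opprB addrA subrK.
apply: le_trans (cnormD _ _) _; apply: lerD; apply: le_trans (cnormZ _ _) _.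
  rewrite mulrC; apply: ler_pM; rewrite ?cnorm_ge0 //.
    by apply/phi_eps/enorm_unitv/enorm_gt0.
  exact: le_trans (ler_dist_dist _ _) uv.
rewrite normr_id; have [->|v0] := eqVneq v 0; first by rewrite normr0 mul0r.
exact: phi_S.
Qed.

End Cone.

(** The retraction sends a segment of the ball to a path in the singularity
    that is at most A times as long. *)
Lemma lipschitz_on_retract l (r K A eps : R) m (g : 'rV[C]_n.+1 -> 'rV[C]_m)
    (pi : 'rV[C]_n.+1 -> 'rV[C]_n.+1) (q y y' : 'rV[C]_n.+1) :
  0 <= A -> path_lipschitz (ball_singularity l r) K g ->
  (forall p, cnorm (p - q) <= eps -> ball_singularity l r (pi p)) ->
  (forall p p', cnorm (p - q) <= eps -> cnorm (p' - q) <= eps ->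
     cnorm (pi p - pi p') <= A * cnorm (p - p')) ->
  cnorm (y - q) <= eps -> cnorm (y' - q) <= eps ->
  cnorm (g (pi y) - g (pi y')) <= K * (A * cnorm (y - y')).
Proof.
move=> A0 gK pil piA yq y'q.
pose sg (s : R) := y + s%:C%C *: (y' - y).
have sgq s : 0 <= s <= 1 -> cnorm (sg s - q) <= eps.
  case/andP=> s0 s1.
  have -> : sg s - q = (1 - s)%:C%C *: (y - q) + s%:C%C *: (y' - q).
    by apply/rowP => i; rewrite !mxE rmorphB rmorph1; ring.
  apply: le_trans (cnormD _ _) _.
  apply: (@le_trans _ _ ((1 - s) * eps + s * eps)); last lra.
  by apply: lerD; apply: le_trans (cnormZ _ _) _; rewrite ger0_norm ?subr_ge0 //;
    rewrite ler_wpM2l // subr_ge0.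
have sg0 : sg 0 = y by rewrite /sg rmorph0 scale0r addr0.
have sg1 : sg 1 = y' by rewrite /sg rmorph1 scale1r addrC subrK.
have := gK (pi \o sg) (A * cnorm (y - y')).
rewrite /= sg0 sg1; apply; first by rewrite mulr_ge0 ?cnorm_ge0.
split=> [s s01|s t s01 t01] /=; first exact/pil/sgq.
apply: le_trans (piA _ _ (sgq _ s01) (sgq _ t01)) _.
rewrite -mulrA; apply: ler_wpM2l => //.
have -> : sg s - sg t = (t - s)%:C%C *: (y - y').
  by apply/rowP => i; rewrite !mxE rmorphB; ring.
by apply: le_trans (cnormZ _ _) _; rewrite mulrC distrC.
Qed.

(** The largest coordinate of q is either w or among the z_j. In the former
    case the equation of the singularity bounds it in terms of z. *)
Lemma zpart_lower_bound l (q : 'rV[C]_n.+1) (M : R) : (1 < l)%N -> (0 < n)%N ->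
  singularity R n l q -> cnorm q <= 1 -> 0 <= M ->
  (forall j, normc (zpart q j) <= M) -> cnorm q ^+ l <= n%:R * M ^+ 2.
Proof.
move=> l1 n0 ql q1 M0 qM.
have wM := wpart_pow_le ql M0 qM.
have [qleM|Mq] := leP (cnorm q) M.
  apply: (@le_trans _ _ (cnorm q ^+ 2)); first by rewrite ler_wiXn2l ?cnorm_ge0.
  apply: (@le_trans _ _ (1 * M ^+ 2)); first by rewrite mul1r ler_sqr ?nnegrE ?cnorm_ge0.
  by rewrite ler_wpM2r ?sqr_ge0 // ler1n.
apply: le_trans wM; rewrite lerXn2r ?nnegrE ?cnorm_ge0 ?normc_ge0 //.
rewrite leNgt; apply/negP => wq.
have : cnorm q <= Num.max M (normc (wpart q)).
  by apply: cnorm_le_parts => [|j|]; rewrite le_max ?M0 ?qM ?lexx ?orbT.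
by rewrite le_max !leNgt Mq wq.
Qed.

End Contraction.

Theorem theorem3p2 (R : realType) (n k l : nat) (hn : (1 < n)%N)
    (hl : (1 < l)%N) (hkl : (l < k)%N) :
  ~ subanalytically_bilipschitz (real_singularity R n k) (real_singularity R n l).
Proof.
move=> /bilipschitz_path_lipschitz[h [g [r [K [[/andP[r0 r1] K1] h0 hP gP [hK gK]]]]]].
have k1 : (1 < k)%N by apply: ltn_trans hkl.
have K0 : 0 <= K by lra.
pose E : R := 24 * n.+1%:R * K.
have E0 : 0 <= E by rewrite !mulr_ge0.
have [A A0 retraction] := local_retraction R hn hl.
(* The three conditions ensure, in this order, that the image of the sphere is
   small compared with the z-part, that its contraction stays in the ball of
   radius r, and that w stays close to t^2 along the contraction pulled back
   by g. *)
have [t [/andP[t0 t1] T1 T2 T3]] : exists t : R, [/\ 0 < t <= 1,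
    n%:R * (K * l%:R) ^+ l * (16 * E ^+ 2) * t <= 1,
    2 * (K * k%:R + A * E) / r * t <= 1 &
    K * A * E * (k%:R * 2 ^+ k) * t <= 1].
  apply: small_parameter.
  - by rewrite !mulr_ge0 ?exprn_ge0 ?mulr_ge0 ?sqr_ge0.
  - by rewrite divr_ge0 ?mulr_ge0 ?addr_ge0 ?mulr_ge0 // ltW.
  - by rewrite !mulr_ge0 ?exprn_ge0.
have t01 : 0 <= t <= 1 by rewrite ltW.
have t0' := ltW t0.
pose eps := E * t ^+ k.
have eps0 : 0 <= eps by rewrite mulr_ge0 ?exprn_ge0.
have tk j : (j <= k)%N -> t ^+ k <= t ^+ j by move=> jk; rewrite ler_wiXn2l.
have r2 : (K * k%:R + A * E) * t <= r / 2.
  move: T2; rewrite mulrAC ler_pdivrMr // mul1r; lra.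
have Kk1 : 1 <= K * k%:R by rewrite mulr_ege1 // ler1n ltnW.
have AE0 : 0 <= A * E by rewrite mulr_ge0.
have Kkt : K * k%:R * t <= r / 2 by apply: le_trans r2; rewrite ler_wpM2r // lerDl.
have t2t : t ^+ 2 <= t by rewrite -[leRHS]expr1 ler_wiXn2l.
have tr : t ^+ 2 < r.
  apply: le_lt_trans t2t _; apply: (@le_lt_trans _ _ (K * k%:R * t)); last lra.
  by rewrite ler_peMl.
pose i0 : 'I_n := Ordinal (ltnW hn).
pose e0 : 'rV[R]_n := delta_mx 0 i0.
have e0n : enorm e0 = 1 := enorm_delta R i0.
pose p0 := vsphere k t e0; pose q := h p0.
have ball_vsphere (u : 'rV[R]_n) : enorm u = 1 -> ball_singularity k r (vsphere k t u).
  by move=> u1; apply: vsphere_ball.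
have p0k := ball_vsphere _ e0n.
have [ql gq] := hP _ p0k; rewrite -/q in ql gq.
have q_le : cnorm q <= K * k%:R * t ^+ 2.
  have := radial_lipschitz k1 hK p0k; rewrite h0 subr0 => /le_trans; apply.
  by rewrite mulrA ler_wpM2l ?mulr_ge0 // cnorm_vsphere.
have q_le2 : cnorm q <= r / 2.
  by apply: le_trans q_le _; apply: le_trans Kkt; rewrite ler_wpM2l ?mulr_ge0.
have qr : ball_singularity l r q by split=> //; apply: le_lt_trans q_le2 _; lra.
have g0 : g 0 = 0.
  have z0 : ball_singularity k r (0 : 'rV[R[i]%C]_n.+1).
    split; last by rewrite cnorm0.
    by apply: singularity0; apply: ltnW.
  by have [_] := hP _ z0; rewrite h0.
(* g is Lipschitz as well, so h cannot move p0 much closer to the origin. *)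
have q_ge : t ^+ 2 <= K * l%:R * cnorm q.
  have := radial_lipschitz hl gK qr; rewrite g0 subr0 gq mulrA; apply: le_trans.
  by apply: le_trans (wpart_le _); rewrite wpart_point normcR ger0_norm ?sqr_ge0.
have [j0 [M [Mdef Mmax]]] : exists j0 : 'I_n, exists M : R,
    normc (zpart q j0) = M /\ forall j, normc (zpart q j) <= M.
  case: (@arg_maxP _ _ _ i0 predT (fun j => normc (zpart q j)) isT) => j0 _ jM.
  by exists j0, (normc (zpart q j0)); split=> // j; exact: jM.
have M0 : 0 <= M by rewrite -Mdef normc_ge0.
have M1 : M <= 1 by rewrite -Mdef; apply: le_trans (zpart_le _ _) _; lra.
have q1 : cnorm q <= 1 by lra.
have Mlow : t ^+ (2 * l) <= (K * l%:R) ^+ l * (n%:R * M ^+ 2).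
  apply: le_trans (_ : (K * l%:R * cnorm q) ^+ l <= _).
    by rewrite exprM lerXn2r ?nnegrE ?sqr_ge0 ?mulr_ge0 ?cnorm_ge0.
  rewrite exprMn ler_wpM2l ?exprn_ge0 ?mulr_ge0 //.
  by apply: zpart_lower_bound => //; exact: ltnW.
have Mpos : 0 < M.
  rewrite lt_neqAle M0 andbT; apply/eqP => ME.
  by move: Mlow; rewrite -ME expr0n !mulr0 leNgt exprn_gt0.
have epsM : 4 * eps <= M.
  have eps4 : 0 <= 4 * eps by rewrite pmulr_rge0.
  rewrite -ler_sqr ?nnegrE //.
  pose c : R := n%:R * (K * l%:R) ^+ l.
  have E16 : 0 <= 16 * E ^+ 2 by rewrite mulr_ge0 ?sqr_ge0.
  have -> : (4 * eps) ^+ 2 = 16 * E ^+ 2 * t ^+ (2 * k).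
    by rewrite /eps mulnC exprM; ring.
  apply: (@le_trans _ _ (16 * E ^+ 2 * (t * t ^+ (2 * l)))).
    (* k > l leaves a factor t to spare *)
    rewrite ler_wpM2l // -exprS ler_wiXn2l //; move: (hkl); clear; lia.
  apply: (@le_trans _ _ (16 * E ^+ 2 * (t * (c * M ^+ 2)))).
    by rewrite !ler_wpM2l // (le_trans Mlow) // /c mulrCA mulrA.
  have -> : 16 * E ^+ 2 * (t * (c * M ^+ 2)) = c * (16 * E ^+ 2) * t * M ^+ 2 by ring.
  by rewrite ler_piMl ?sqr_ge0.
have M01 : 0 < M <= 1 by rewrite Mpos.
have wq1 : normc (wpart q) <= 1 by apply: le_trans (wpart_le _) q1.
have [pi [pil piid piA]] := retraction _ _ _ _ ql Mdef Mmax M01 wq1 eps0 epsM.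
have qq : cnorm (q - q) <= eps by rewrite subrr cnorm0.
have epst j : (j <= k)%N -> eps <= E * t ^+ j by move=> jk; rewrite ler_wpM2l ?tk.
have pi_ball p : cnorm (p - q) <= eps -> ball_singularity l r (pi p).
  move=> pq; split; first exact: pil.
  have : cnorm (pi p) <= cnorm (pi p - pi q) + cnorm q.
    by apply: le_trans (cnormD _ _); rewrite (piid _ ql) subrK.
  have : cnorm (pi p - pi q) <= A * E * t.
    apply: le_trans (piA _ _ pq qq) _; rewrite -mulrA ler_wpM2l //.
    by apply: le_trans pq _; rewrite -[t]expr1 epst // ltnW.
  have : cnorm q <= K * k%:R * t.
    by apply: le_trans q_le _; rewrite ler_wpM2l ?mulr_ge0.
  move: r2; rewrite mulrDl; lra.
pose phi u := h (vsphere k t u).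
pose S : R := n%:R * (24 * n.+1%:R * K * t ^+ k) + K * (2 * n.+1%:R * n.+1%:R * t ^+ k).
have S0 : 0 <= S by rewrite addr_ge0 ?mulr_ge0 ?exprn_ge0.
have phi_eps (u : 'rV[R]_n) : enorm u = 1 -> cnorm (phi u - q) <= eps.
  by move=> u1; apply: (sphere_diameter k1 t01 tr K0 hK hn u1 e0n).
have phi_S (u v : 'rV[R]_n) (d : R) : u != 0 -> v != 0 -> 0 <= d ->
    (forall i, `|u 0 i - v 0 i| <= d) ->
    `|v| * cnorm (phi (unitv u) - phi (unitv v)) <= S * d.
  exact: (sphere_spread k1 t01 tr K0 hK hn).
have cone_eps (v : 'rV[R]_n) : in_cube v -> cnorm (cone phi q v - q) <= eps.
  move=> vc; apply: le_trans (cone_dist phi_eps v) _.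
  by rewrite ler_piMl ?cube_norm_le.
pose G (v : 'rV[R]_n) := g (pi (cone phi q v)).
have Gd y y' := lipschitz_on_retract A0 gK pi_ball piA (y := y) (y' := y').
apply: (@sphere_essential R n k t G (K * A * (eps + S))) => //.
- exact: ltnW.
- move=> v v' d vc v'c d0 vv'.
  apply: le_trans (Gd _ _ (cone_eps _ vc) (cone_eps _ v'c)) _.
  rewrite -!mulrA !ler_wpM2l //.
  exact: (cone_lipschitz eps0 S0 phi_eps phi_S d0 vv').
- by move=> v vc; apply: gP; exact: pi_ball (cone_eps _ vc).
- move=> v vc.
  have -> : (t ^+ 2)%:C%C = wpart (g (pi q)) by rewrite (piid _ ql) gq wpart_point.
  rewrite -wpartB; apply: le_trans (wpart_le _) _.
  apply: le_trans (Gd _ _ (cone_eps _ vc) qq) _.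
  have kk : 0 < k%:R * 2 ^+ k :> R by rewrite mulr_gt0 ?exprn_gt0 // ltr0n ltnW.
  rewrite ler_pdivlMr //.
  apply: (@le_trans _ _ (K * (A * (E * t ^+ 3)) * (k%:R * 2 ^+ k))).
    (* k > l > 1 gives t^k <= t^3, which is small compared with t^2 *)
    rewrite ler_pM2r // !ler_wpM2l // (le_trans (cone_eps _ vc)) // epst //.
    by apply: leq_trans hkl.
  have -> : K * (A * (E * t ^+ 3)) * (k%:R * 2 ^+ k) =
    K * A * E * (k%:R * 2 ^+ k) * t * t ^+ 2 by ring.
  by rewrite ler_piMl ?sqr_ge0.
- move=> v vc v1.
  have v0 : v != 0.
    by apply/eqP => vE; move: v1; rewrite vE normr0 => /eqP; rewrite eq_sym oner_eq0.
  have u1 := enorm_unitv (enorm_gt0 v0).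
  have [hl' ghE] := hP _ (ball_vsphere _ u1).
  have -> : G v = g (pi (phi (unitv v))).
    by rewrite /G /cone v1 rmorph1 scale1r addrC subrK.
  by rewrite piid.
Qed.
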